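(* Let $f: [0, +\infty) \to \mathbb{R}$ be locally Lipschitz continuous and $\kappa \in C^1(\overline{B_1})$ be a non-negative function. Let $u \in C^2(B_1) \cap C^0(\overline{B_1})$ be a solution of $$ \begin{cases} - \Delta u = \kappa f(u) & \text{in } B_1, \\ u > 0 & \text{in } B_1, \\ u = 0 & \text{on } \partial B_1, \end{cases} $$ satisfying $$ \frac{1}{C_0} \big( 1 - |x| \big) \le u(x) \le C_0 \quad \text{for all } x \in B_1, $$ for some constant $C_0 \ge 1$. Then, $$ |u(x) - u(y)| \le C \, \| \nabla \kappa \|_{L^\infty(B_1)}^\alpha \quad \text{for all } x, y \in B_1 \text{ such that } |x| = |y| $$ and $$ \partial_r u(x) < C \, \| \nabla \kappa \|_{L^\infty(B_1)}^\alpha \quad \text{for all } x \in B_1 \setminus \{ 0 \}, $$ for some constants $\alpha \in (0, 1]$ and $C > 0$ depending only on $n$, $\| f \|_{C^{0, 1}([0, C_0])}$, $\|\kappa\|_{L^\infty(B_1)}$, and $C_0$.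
   Context: $n \ge 2$ is an integer and $B_1 \subset \mathbb{R}^n$ is the open unit ball centered at the origin. $\partial_r := \frac{x}{|x|} \cdot \nabla$ is the radial derivative. $\|f\|_{C^{0,1}([0,C_0])}$ is the full Lipschitz norm (sup norm plus Lipschitz seminorm) of $f$ on $[0,C_0]$. Here $f$ is not assumed to have a sign. ''Depending only on'' means that $\alpha$ and $C$ can be chosen as functions of the listed quantities alone (otherwise independent of $u$, $f$, $\kappa$). *)

(* Defs.v *)
From mathcomp Require Export all_boot all_order all_algebra.
From mathcomp Require Export all_classical all_reals all_analysis.
Export Order.TTheory GRing.Theory Num.Theory numFieldNormedType.Exports.

Set Implicit Arguments.
Unset Strict Implicit.
Unset Printing Implicit Defensive.

Local Open Scope classical_set_scope.
Local Open Scope ring_scope.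

Section Euclidean.
Context {R : realType} {n : nat}.
Implicit Types (x : 'rV[R]_n) (Omega : set 'rV[R]_n) (g : 'rV[R]_n -> R).

(* The library norm `|x| on row vectors is the sup norm; it induces the same
   topology, but the ball and |x| of the statement are Euclidean. *)
Definition enorm x : R := Num.sqrt (\sum_(i < n) x 0 i ^+ 2).

Definition unit_ball : set 'rV[R]_n := [set x | enorm x < 1].

Definition boundary Omega : set 'rV[R]_n := closure Omega `\` Omega°.

Definition partial (i : 'I_n) g : 'rV[R]_n -> R := 'D_(delta_mx 0 i) g.

Definition grad g x : 'rV[R]_n := \row_(i < n) partial i g x.

Definition laplacian g x : R := \sum_(i < n) partial i (partial i g) x.

(* (x / |x|) . grad g; meaningful for x != 0 only. *)
Definition radial_derivative g x : R :=
  \sum_(i < n) x 0 i / enorm x * grad g x 0 i.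

(* C^k(Omega), Omega open *)
Fixpoint Ck (k : nat) Omega g : Prop :=
  (forall x, Omega x -> {for x, continuous g}) /\
  if k is k'.+1 then
    forall i : 'I_n, (forall x, Omega x -> derivable g x (delta_mx 0 i)) /\
                     Ck k' Omega (partial i g)
  else True.

(* C^1 up to the boundary: g and its first derivatives extend continuously. *)
Definition C1_closure Omega g : Prop :=
  [/\ Ck 1 Omega g, {within closure Omega, continuous g} &
      forall i : 'I_n, exists h : 'rV[R]_n -> R,
        {within closure Omega, continuous h} /\
        (forall x, Omega x -> h x = partial i g x)].

(* Lebesgue-null sets: coverable by countably many boxes of arbitrarily small
   total volume (the library has no Lebesgue measure on R^n). *)
Definition lebesgue_null (A : set 'rV[R]_n) : Prop :=
  forall e : R, 0 < e -> exists a b : nat -> 'rV[R]_n,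
    [/\ forall k (i : 'I_n), a k 0 i <= b k 0 i,
        A `<=` \bigcup_k [set x | forall i : 'I_n, a k 0 i <= x 0 i <= b k 0 i] &
        forall N : nat, \sum_(k < N) \prod_(i < n) (b k 0 i - a k 0 i) <= e].

(* Essential supremum of |g| over Omega; used for essentially bounded g. *)
Definition Linfty_norm Omega g : R :=
  inf [set M : R | 0 <= M /\ lebesgue_null [set x | Omega x /\ M < `|g x|]].

End Euclidean.

Section Lipschitz.
Context {R : realType}.
Implicit Types f : R -> R.

(* Functions on [0, +oo) are total functions whose values at negative
   arguments are never used. *)
Definition locally_lipschitz_nneg f : Prop :=
  [locally [lipschitz f x | x in [set t : R | 0 <= t]]].

(* Full C^{0,1}([a, b]) norm: sup norm plus Lipschitz seminorm. *)
Definition lipschitz_norm f (a b : R) : R :=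
  sup [set r | exists2 t, a <= t <= b & r = `|f t|] +
  sup [set r | exists s t, [/\ a <= s <= b, a <= t <= b, s != t &
                               r = `|f s - f t| / `|s - t|]].

End Lipschitz.

(* Main.v *)
Require Import Defs.
From mathcomp Require Import ring lra.

(* Moving planes with explicit barriers; the exponent obtained is alpha = 1.
   For a unit vector e and 0 <= l < 1 let R_l be the reflection in {x.e = l},
   w_l = u o R_l - u on the cap {|x| < 1, t > 0}, t = x.e - l.  With Lam = K L and
   eps = |grad kappa|, the equation gives |Lap w_l| <= Lam |w_l| + 2 L eps t.  On the
   spherical part of the cap w_l = u o R_l, which the assumed lower bound on u makes
   at least 2 l t / C0; on the flat part w_l = 0.
   - Quadratic barriers in t give |w_l| <= M t, hence u is Lipschitz on the ball.
   - If w_l >= 0, then q(t) = A (exp(B t) - 1), B = Lam + 1, is a subsolution below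
     w_l on the boundary of the cap as soon as A ~ l and A > 2 L eps, so w_l >= q.
     This replaces the Harnack inequality: the bound is strict by an amount
     independent of u.  By the Lipschitz bound it survives, with A halved, away from
     the flat part when l is decreased by a fixed step, and the maximum principle in
     a narrow strip recovers it near the flat part.  Hence finitely many steps lead
     from l = 1 down to any l = rho > C eps.
   - Thus u(z) >= u(x) whenever |z| <= |x| - 2 rho, and the Lipschitz bound yields
     u(z) >= u(x) - C eps for |z| <= |x|.  So w_l >= -C eps for every l >= 0, and one
     more barrier vanishing at t = 0 turns this into w_l >= -C eps t, which bounds the
     radial derivative.  For eps = 0 the bound w_l >= q gives the strict sign. *)

Set Implicit Arguments.
Unset Strict Implicit.
Unset Printing Implicit Defensive.

Local Open Scope classical_set_scope.
Local Open Scope ring_scope.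

(** * Boxes with nonempty interior are not Lebesgue-null *)

Section NullSets.
Context {R : realType}.

(** Length of the intersection of [[a, b]] and [[l, r]]; products of these over the coordinates are
    volumes of intersections of boxes. *)
Definition overlap (a b l r : R) : R := Num.max 0 (Num.min b r - Num.max a l).

Lemma overlap_ge0 a b l r : 0 <= overlap a b l r.
Proof. by rewrite /overlap le_max lexx. Qed.

Lemma overlap_le a b l r : a <= b -> overlap a b l r <= b - a.
Proof.
rewrite /overlap => ab; rewrite ge_max subr_ge0 ab /=.
by rewrite lerB // ?ge_min ?le_max ?lexx.
Qed.

Lemma overlap_inside a b l r : a <= l -> l <= r -> r <= b -> overlap a b l r = r - l.
Proof.
move=> al lr rb; rewrite /overlap min_r // max_r // max_r // subr_ge0 //.
Qed.

Lemma overlap_split a b l m r : a <= b -> l <= m -> m <= r ->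
  overlap a b l m + overlap a b m r = overlap a b l r.
Proof.
rewrite /overlap => ab lm mr.
case: (leP b m); case: (leP b r); case: (leP a l); case: (leP a m) => *.
all: repeat match goal with |- context[Num.max 0 ?X] => case: (leP 0 X) => ? end; lra.
Qed.

Variable n : nat.
Implicit Types (a b : nat -> 'I_n -> R) (l r : 'I_n -> R).

(** The boxes [[a k, b k]], counted with multiplicity, fill at most half of the box [[l, r]].
    Bounding all partial sums avoids infinite series. *)
Definition underfilled a b l r :=
  (forall i, l i < r i) /\
  forall N, \sum_(k < N) \prod_i overlap (a k i) (b k i) (l i) (r i) <=
            2^-1 * \prod_i (r i - l i).

(* If all 2^n half-size subboxes were overfilled, summing over them would overfill the
   whole box. *)
Lemma underfilled_halve a b l r : (forall k i, a k i <= b k i) ->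
  underfilled a b l r ->
  exists l' r', [/\ underfilled a b l' r', forall i, l i <= l' i, forall i, r' i <= r i &
    forall i, r' i - l' i = (r i - l i) / 2].
Proof.
move=> ab [lr bad].
pose m i := (l i + r i) / 2.
pose l' (c : {ffun 'I_n -> bool}) i := if c i then m i else l i.
pose r' (c : {ffun 'I_n -> bool}) i := if c i then r i else m i.
have lm i : l i < m i by have := lr i; rewrite /m; lra.
have mr i : m i < r i by have := lr i; rewrite /m; lra.
have [[c Hc]|H] := pselect (exists c, underfilled a b (l' c) (r' c)).
  exists (l' c), (r' c); split => // i; rewrite /l' /r'; case: (c i) => //.
  - exact: ltW.
  - exact: ltW.
  - by rewrite /m; field.
  - by rewrite /m; field.
exfalso.
have {}H c : exists N, 2^-1 * \prod_i (r' c i - l' c i) <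
    \sum_(k < N) \prod_i overlap (a k i) (b k i) (l' c i) (r' c i).
  apply: contrapT => H1; apply: H; exists c; split.
    by move=> i; rewrite /l' /r'; case: (c i).
  move=> N; rewrite leNgt; apply/negP => H2; apply: H1; by exists N.
have [N HN] := choice H.
(* There are finitely many subboxes and all terms are nonnegative, so the largest truncation index
   serves every subbox. *)
pose M := \max_c N c.
have HM c : 2^-1 * \prod_i (r' c i - l' c i) <
    \sum_(k < M) \prod_i overlap (a k i) (b k i) (l' c i) (r' c i).
  apply: lt_le_trans (HN c) _.
  rewrite -(subnKC (leq_bigmax c : (N c <= M)%N)) big_split_ord /= lerDl.
  by apply: sumr_ge0 => k _; apply: prodr_ge0 => i _; exact: overlap_ge0.
have : \sum_c (2^-1 * \prod_i (r' c i - l' c i)) <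
    \sum_c \sum_(k < M) \prod_i overlap (a k i) (b k i) (l' c i) (r' c i).
  apply: ltr_sum => //; apply/hasP; exists [ffun => true] => //.
rewrite exchange_big /= -mulr_sumr.
(* Distributivity: summing products over all choices [c] of halves is the product over the
   coordinates of the sums of the two halves. The same expansion is used below for the overlaps. *)
have -> : \sum_c \prod_i (r' c i - l' c i) = \prod_i (r i - l i).
  rewrite -(bigA_distr_bigA (fun i (c : bool) =>
    (if c then r i else m i) - (if c then m i else l i))).
  by apply: eq_bigr => i _; rewrite big_bool /=; ring.
under [X in _ < X]eq_bigr => k _.
  rewrite (_ : \sum_c _ = \prod_i overlap (a k i) (b k i) (l i) (r i)).
    over.
  rewrite -(bigA_distr_bigA (fun i (c : bool) => overlap (a k i) (b k i)
     (if c then m i else l i) (if c then r i else m i))).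
  by apply: eq_bigr => i _; rewrite big_bool /= addrC overlap_split // ltW.
by rewrite ltNge bad.
Qed.

(* Repeated halving shrinks to a point interior to some box of the cover, which then
   fills the small boxes completely. *)
Lemma cube_cover_volume a b l r :
  (forall k i, a k i <= b k i) -> (forall i, l i < r i) ->
  (forall x : 'I_n -> R, (forall i, l i <= x i <= r i) ->
     exists k, forall i, a k i < x i < b k i) ->
  ~ (forall N, \sum_(k < N) \prod_i (b k i - a k i) <= 2^-1 * \prod_i (r i - l i)).
Proof.
move=> ab lr cov small.
pose S := {p : ('I_n -> R) * ('I_n -> R) | underfilled a b p.1 p.2}.
have init : underfilled a b l r.
  split=> // N; apply: le_trans (small N); apply: ler_sum => k _.
  by apply: ler_prod => i _; rewrite overlap_ge0 overlap_le.
have step (s : S) : exists s' : S, [/\ forall i, (sval s).1 i <= (sval s').1 i,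
    forall i, (sval s').2 i <= (sval s).2 i &
    forall i, (sval s').2 i - (sval s').1 i = ((sval s).2 i - (sval s).1 i) / 2].
  have [l' [r' [H1 H2 H3 H4]]] := underfilled_halve ab (svalP s).
  by exists (exist _ (l', r') H1).
have [F HF] := choice step.
pose s m := iter m F (exist _ (l, r) init : S).
pose lo m i := (sval (s m)).1 i.
pose hi m i := (sval (s m)).2 i.
have len m i : hi m i - lo m i = (r i - l i) / 2 ^+ m.
  elim: m => [|m IH]; first by rewrite expr0 divr1.
  rewrite /hi /lo /s iterS; have [_ _ ->] := HF (iter m F (exist _ (l, r) init : S)).
  by rewrite -/(s m) -/(hi m i) -/(lo m i) IH exprS invfM; ring.
have lohi m i : lo m i < hi m i.
  by rewrite /lo /hi; have [H _] := svalP (s m); exact: H.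
have lomono i : {homo lo^~ i : p q / (p <= q)%N >-> p <= q}.
  apply: homo_leq; [by []|exact: le_trans|] => m.
  by rewrite /lo /s iterS; have [H _ _] := HF (iter m F (exist _ (l, r) init : S)).
have himono i : {homo hi^~ i : p q / (p <= q)%N >-> q <= p}.
  apply: (homo_leq (r := fun x y => y <= x)) => [//|y x z yx zy|m].
    exact: le_trans zy yx.
  by rewrite /hi /s iterS; have [_ H _] := HF (iter m F (exist _ (l, r) init : S)).
have lohi2 p q i : lo p i <= hi q i.
  apply: (le_trans (lomono i _ _ (leq_maxl p q))).
  apply: (le_trans (ltW (lohi _ _))); apply: himono; exact: leq_maxr.
pose x i := sup (range (lo^~ i)).
have xlo m i : lo m i <= x i.
  apply: ub_le_sup; last by exists m.
  by exists (hi 0%N i) => _ [q _ <-].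
have xhi m i : x i <= hi m i.
  apply: ge_sup; first by exists (lo 0%N i), 0%N.
  by move=> _ [q _ <-].
have [k Hk] : exists k, forall i, a k i < x i < b k i.
  by apply: cov => i; rewrite (xlo 0%N) (xhi 0%N).
(* The side lengths tend to 0 and the limit point lies strictly inside box [k]; since the
   coordinates are finitely many, one [m] puts the whole small box inside. *)
have [m Hm] : exists m : nat, forall i, a k i < lo m i /\ hi m i < b k i.
  suff : \forall m \near \oo, forall i, a k i < lo m i /\ hi m i < b k i.
    by case=> m _ Hm; exists m; apply: Hm => /=.
  apply: (@filter_forall _ _ (fun i m => a k i < lo m i /\ hi m i < b k i)) => i.
  have /andP[H1 H2] := Hk i.
  pose d := Num.min (x i - a k i) (b k i - x i).
  have d0 : 0 < d by rewrite lt_min !subr_gt0 H1.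
  have : (fun m : nat => (r i - l i) / 2 ^+ m) @ \oo --> (r i - l i) * 0.
    apply: cvgM; first exact: cvg_cst.
    rewrite (_ : (fun m => (2 ^+ m)^-1) = GRing.exp 2^-1).
      by apply: cvg_expr; rewrite ger0_norm ?invr_ge0 // invf_lt1 // ltr1n.
    by apply/funext => m; rewrite exprVn.
  move/cvgr_lt => /(_ d); rewrite mulr0 => /(_ d0).
  apply: filterS => m; rewrite -len /d lt_min => /andP[h1 h2].
  have := xlo m i; have := xhi m i; lra.
(* The partial sum up to and including index [k] already contains the full volume of the small box,
   against the bound by one half. *)
have [_ /(_ k.+1)] := svalP (s m).
rewrite big_ord_recr /= -/(lo m) -/(hi m).
rewrite [X in _ + X](_ : _ = \prod_i (hi m i - lo m i)); last first.
  by apply: eq_bigr => i _; apply: overlap_inside; apply: ltW;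
    have [? ?] := Hm i; have ? := lohi m i.
have P : 0 < \prod_i (hi m i - lo m i) by apply: prodr_gt0 => i _; rewrite subr_gt0.
have S0 : 0 <= \sum_(j < k) \prod_i overlap (a j i) (b j i)
    ((sval (s m)).1 i) ((sval (s m)).2 i).
  by apply: sumr_ge0 => j _; apply: prodr_ge0 => i _; exact: overlap_ge0.
have Q : \prod_i ((sval (s m)).2 i - (sval (s m)).1 i) = \prod_i (hi m i - lo m i) by [].
rewrite Q; lra.
Qed.

(** Take a cover by closed boxes of total volume at most [V / 4] and enlarge box [k] by at most
    [V / 4 * 2^-(k+1)] in volume. The open enlarged boxes still cover, with total volume at most
    [V / 2], which [cube_cover_volume] excludes. *)
Lemma lebesgue_nullN_cube (A : set 'rV[R]_n) (l r : 'rV[R]_n) :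
  (forall i : 'I_n, l 0 i < r 0 i) ->
  (forall x : 'rV[R]_n, (forall i : 'I_n, l 0 i <= x 0 i <= r 0 i) -> A x) ->
  ~ lebesgue_null A.
Proof.
move=> lr boxA null.
pose V := \prod_i (r 0 i - l 0 i).
have V0 : 0 < V by apply: prodr_gt0 => i _; rewrite subr_gt0.
have V40 : 0 < V / 4 by rewrite divr_gt0.
have [a [b [ab cov vol]]] := null _ V40.
have fat k : exists e : R, 0 < e /\
    \prod_i ((b k 0 i + e) - (a k 0 i - e)) <=
    \prod_i (b k 0 i - a k 0 i) + V / 4 * (2^-1) ^+ k.+1.
  have : (fun e : R => \prod_i ((b k 0 i + e) - (a k 0 i - e))) @ 0 -->
      \prod_i ((b k 0 i + 0) - (a k 0 i - 0)).
    apply: cvg_big; first exact: mul_continuous.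
    move=> i _; apply: cvgB; first by apply: cvgD; [exact: cvg_cst|exact: cvg_id].
    by apply: cvgB; [exact: cvg_cst|exact: cvg_id].
  under [X in _ --> X]eq_bigr do rewrite addr0 subr0.
  move/cvgr_le => /(_ (\prod_i (b k 0 i - a k 0 i) + V / 4 * (2^-1) ^+ k.+1)).
  rewrite ltrDl mulr_gt0 ?exprn_gt0 ?invr_gt0 ?divr_gt0 // => /(_ isT).
  case/nbhs_ballP => e /= e0 He; exists (e / 2); split; first by rewrite divr_gt0.
  apply: He; rewrite /ball /= sub0r normrN gtr0_norm ?divr_gt0 //; lra.
have [e He] := choice fat.
apply: (@cube_cover_volume (fun k i => a k 0 i - e k) (fun k i => b k 0 i + e k)
   (fun i => l 0 i) (fun i => r 0 i)) => //.
- move=> k i; have := ab k i; have [] := He k; lra.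
- move=> x Hx; have /cov[k _ /= Hk] : A (\row_i x i).
    by apply: boxA => i; rewrite mxE.
  exists k => i; have := Hk i; rewrite mxE; have [e0 _] := He k.
  by move=> /andP[h1 h2]; apply/andP; split; lra.
- move=> N; apply: (@le_trans _ _ (\sum_(k < N) (\prod_i (b k 0 i - a k 0 i)
      + V / 4 * (2^-1) ^+ k.+1))).
    by apply: ler_sum => k _; have [] := He k.
  rewrite big_split /= -mulr_sumr.
  have -> : \sum_(k < N) (2^-1 : R) ^+ k.+1 = 1 - 2^-1 ^+ N.
    elim: N => [|N IH]; first by rewrite big_ord0 expr0 subrr.
    by rewrite big_ord_recr /= IH exprS; field.
  have := vol N; rewrite -/V.
  have : V / 4 * (1 - 2^-1 ^+ N) <= V / 4.
    rewrite ler_piMr ?divr_ge0 ?ltW // gerBl exprn_ge0 // invr_ge0 //.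
  lra.
Qed.

End NullSets.

(** The hypothesis supplies a constant near each pair [(s, t)]; compactness of the square makes it
    uniform, as a near-covering argument with the constant tending to infinity. *)
Lemma locally_lipschitz_segment (R : realType) (f : R -> R) (c : R) :
  locally_lipschitz_nneg f ->
  exists M, 0 <= M /\ forall s t, 0 <= s <= c -> 0 <= t <= c ->
    `|f s - f t| <= M * `|s - t|.
Proof.
move=> hf.
have cK : compact (`[0, c]%classic `*` `[0, c]%classic : set (R * R)).
  by apply: compact_setX; exact: segment_compact.
move/compact_near_coveringP in cK.
have := cK R +oo (fun M p => 0 <= p.1 -> 0 <= p.2 ->
   `|f p.1 - f p.2| <= M * `|p.1 - p.2|) _.
case.
  move=> [s t] /= [].
  rewrite !in_itv /= => /andP[s0 _] /andP[t0 _].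
  have /= := hf (s, t) (conj s0 t0).
  case/pinfty_ex_gt0 => M0 M00 HM0.
  rewrite /dominated_by /within /= in HM0.
  exists ([set p | 0 <= p.1 -> 0 <= p.2 -> `|f p.1 - f p.2| <= M0 * `|p.1 - p.2|],
          [set M | M0 <= M]).
    split => /=; last by apply: nbhs_pinfty_ge; exact: num_real.
    by apply: filterS HM0 => -[p q] /= H p0 q0; apply: H.
  move=> [[p q] M] /= [H1 H2] p0 q0; apply: (le_trans (H1 p0 q0)).
  by apply: ler_wpM2r.
move=> M [_ HM]; exists (`|M| + 1); split; first by rewrite addr_ge0.
move=> s t /andP[s0 sc] /andP[t0 tc].
apply: (HM _ _ (s, t)) => //=; first by rewrite (le_lt_trans (ler_norm M)) // ltrDl.
by rewrite !in_itv /= s0 sc t0.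
Qed.

(** * Differentiation along lines *)

Section Lines.
Context {R : realType} {n : nat}.
Implicit Types (x v p : 'rV[R]_n) (Omega : set 'rV[R]_n) (g : 'rV[R]_n -> R).

Lemma is_derive_coordinate_line g x i (c s : R) :
  derivable g (x + (s * c) *: delta_mx 0 i) (delta_mx 0 i) ->
  is_derive s 1 (fun h : R => g (x + (h * c) *: delta_mx 0 i))
    (c * partial i g (x + (s * c) *: delta_mx 0 i)).
Proof.
set y := x + _ => /derivableP dg.
have H : is_derive (c * (s - s)) 1 (fun h : R => g (h *: delta_mx 0 i + y)) (partial i g y).
  rewrite subrr mulr0; split.
    by have [/derivable1P] := dg.
  rewrite /partial /derive; set g1 := fun h => h^-1 *: _; set g2 := fun h => h^-1 *: _.
  suff -> : g1 = g2 by [].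
  by rewrite funeqE /g1 /g2 => h /=; rewrite addr0 scale0r add0r [_%:A]mulr1.
have A : is_derive s 1 (fun h : R => c * (h - s)) c.
  by apply: is_derive_eq; rewrite subr0 [_ *: _]mulr1.
have C := @is_derive1_comp _ _ (fun h : R => c * (h - s)) s _ _ H A.
rewrite (_ : (fun h => _) =
  (fun h : R => g (h *: delta_mx 0 i + y)) \o (fun h => c * (h - s))).
  by apply: is_derive_eq C _; rewrite mulrC.
apply/funext => h /=; congr g; rewrite /y addrCA -scalerDl; congr (_ + _ *: _).
by ring.
Qed.

Lemma coordinate_mvt g x i (c : R) :
  (forall t : R, 0 <= t <= 1 -> derivable g (x + (t * c) *: delta_mx 0 i) (delta_mx 0 i)) ->
  exists2 t : R, 0 <= t <= 1 &
    g (x + c *: delta_mx 0 i) - g x = c * partial i g (x + (t * c) *: delta_mx 0 i).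
Proof.
move=> dg.
pose h (t : R) := g (x + (t * c) *: delta_mx 0 i).
pose dh (t : R) := c * partial i g (x + (t * c) *: delta_mx 0 i).
have D (t : R) : 0 <= t <= 1 -> is_derive t 1 h (dh t).
  by move=> tI; apply: is_derive_coordinate_line; exact: dg.
have C : {within `[0, 1], continuous h}.
  by apply: derivable_within_continuous => t; rewrite in_itv /= => /D[].
have [t] := MVT_segment ler01
  (fun (t : R) (tI : t \in `]0, 1[) => D t (subset_itv_oo_cc tI)) C.
rewrite in_itv /h /dh /= mul1r mul0r scale0r addr0 subr0 mulr1 => tI E.
by exists t.
Qed.

(** The base point [q h] moves with [h], so the mean value theorem is applied on a moving segment
    and continuity of the partial derivative at [p] gives the limit. This is the one-coordinate step
    of [is_derive_line]. *)
Lemma coordinate_quotient_cvg g i (c : R) p (q : R -> 'rV[R]_n) :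
  (\forall y \near p, derivable g y (delta_mx 0 i)) ->
  {for p, continuous (partial i g)} ->
  q h @[h --> 0] --> p ->
  h^-1 * (g (q h + (h * c) *: delta_mx 0 i) - g (q h)) @[h --> 0^'] -->
    c * partial i g p.
Proof.
move=> dg cg qp.
(* A property valid near [p] holds on the whole segment starting at [q h] once [h] is small. *)
have key : forall P : set 'rV[R]_n, (\forall y \near p, P y) ->
    \forall h \near (0 : R), forall t : R, 0 <= t <= 1 ->
      P (q h + (t * (h * c)) *: delta_mx 0 i).
  move=> P /nbhs_ballP[r /= r0 rP].
  have /cvgrPdist_lt qr := qp.
  have H1 := qr (r / 2) (divr_gt0 r0 (ltr0n _ 2)).
  have H2 : \forall h \near (0 : R), `|h| * `|c *: (delta_mx 0 i : 'rV[R]_n)| < r / 2.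
    have : (fun h : R => `|h| * `|c *: (delta_mx 0 i : 'rV[R]_n)|) @ 0 -->
        `|0 : R| * `|c *: (delta_mx 0 i : 'rV[R]_n)|.
      by apply: cvgM; [apply: cvg_norm; exact: cvg_id|exact: cvg_cst].
    by move/cvgr_lt; apply; rewrite normr0 mul0r divr_gt0.
  near=> h => t /andP[t0 t1]; apply: rP; rewrite -ball_normE /ball_ /=.
  rewrite opprD addrA (le_lt_trans (ler_normB _ _)) // (splitr r) ltrD //.
    by near: h.
  rewrite mulrA -scalerA normrZ normrM (ger0_norm t0) -mulrA.
  apply: (@le_lt_trans _ _ (`|h| * `|c *: (delta_mx 0 i : 'rV[R]_n)|)).
    by rewrite ler_piMl // mulr_ge0.
  by near: h.
apply/cvgrPdist_lt => eps eps0.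
pose eta := eps / (`|c| + 1).
have eta0 : 0 < eta by rewrite divr_gt0 // ltr_wpDl.
have /cvgrPdist_lt /(_ _ eta0) /key K1 := cg.
have K2 := key _ dg.
have Hd : \forall h \near (0 : R)^', h != 0 by exact: nbhs_dnbhs_neq.
have K1' : \forall h \near (0 : R)^', forall t : R, 0 <= t <= 1 ->
   `|partial i g p - partial i g (q h + (t * (h * c)) *: delta_mx 0 i)| < eta.
  exact: cvg_within.
have K2' : \forall h \near (0 : R)^', forall t : R, 0 <= t <= 1 ->
   derivable g (q h + (t * (h * c)) *: delta_mx 0 i) (delta_mx 0 i).
  exact: cvg_within.
near=> h.
have h0 : h != 0 by near: h.
have [t tI ->] : exists2 t : R, 0 <= t <= 1 &
    g (q h + (h * c) *: delta_mx 0 i) - g (q h) =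
    (h * c) * partial i g (q h + (t * (h * c)) *: delta_mx 0 i).
  by apply: coordinate_mvt; near: h.
rewrite mulrA (mulrA h^-1) mulVf // mul1r -mulrBr normrM.
have : `|partial i g p - partial i g (q h + (t * (h * c)) *: delta_mx 0 i)| < eta.
  by move: t tI; near: h.
rewrite /eta ltr_pdivlMr ?ltr_wpDl // mulrC mulrDl mul1r.
by apply: le_lt_trans; rewrite lerDl.
Unshelve. all: by end_near. Qed.

(** The increment along [v] is telescoped through points that change one coordinate at a time: [w k]
    keeps the first [k] coordinates of [v] and is 0 in the others. *)
Lemma is_derive_line Omega g x v (s : R) : open Omega -> Ck 1 Omega g ->
  Omega (x + s *: v) ->
  is_derive s 1 (fun h : R => g (x + h *: v))
    (\sum_i v 0 i * partial i g (x + s *: v)).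
Proof.
move=> oO [cg dg]; set p := x + _ => Op.
pose w (k : nat) : 'rV[R]_n := \row_i (if (i < k)%N then v 0 i else 0).
have wS (k : 'I_n) : w k.+1 = w k + v 0 k *: delta_mx 0 k.
  apply/rowP => j; rewrite !mxE /= ltnS leq_eqVlt.
  have [->|jk] := eqVneq j k; first by rewrite eqxx ltnn /= mulr1 add0r.
  by rewrite (inj_eq val_inj) (negbTE jk) /= mulr0 addr0.
have wn : w n = v by apply/rowP => j; rewrite !mxE ltn_ord.
have w0 : w 0%N = 0 by apply/rowP => j; rewrite !mxE.
pose T (k : 'I_n) (h : R) :=
  h^-1 * (g (p + h *: w k + (h * v 0 k) *: delta_mx 0 k) - g (p + h *: w k)).
have cT (k : 'I_n) : T k h @[h --> 0^'] --> v 0 k * partial k g p.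
  apply: coordinate_quotient_cvg.
  - have : nbhs p Omega by exact: open_nbhs_nbhs.
    by apply: filterS => y Oy; case: (dg k) => H _; apply: H.
  - by case: (dg k) => _ [H _]; apply: H.
  - have : p + h *: w k @[h --> (0 : R)] --> p + 0 *: w k.
      by apply: cvgD; [exact: cvg_cst|by apply: cvgZ; [exact: cvg_id|exact: cvg_cst]].
    by rewrite scale0r addr0.
have cS : (fun h => \sum_i T i h) @ 0^' --> \sum_i v 0 i * partial i g p.
  by apply: cvg_big; [exact: add_continuous|move=> k _; exact: cT].
pose quot (h : R) :=
  h^-1 *: (((fun h : R => g (x + h *: v)) \o shift s) (h *: 1) - g (x + s *: v)).
have main : quot @ 0^' --> \sum_i v 0 i * partial i g p.
  suff -> : quot = (fun h => \sum_i T i h) by [].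
  apply/funext => h; rewrite /quot /=.
  rewrite -mulr_sumr; congr (_ * _).
  have -> : x + (h%:A + s) *: v = p + h *: w n.
    by rewrite wn /p [_%:A]mulr1 scalerDl -addrA [s *: v + _]addrC.
  transitivity (\sum_(k < n) (g (p + h *: w k.+1) - g (p + h *: w k))).
    rewrite -(big_mkord xpredT (fun k => g (p + h *: w k.+1) - g (p + h *: w k))).
    by rewrite telescope_sumr // w0 scaler0 addr0.
  by apply: eq_bigr => k _; rewrite wS scalerDr scalerA addrA.
split; first by apply/cvg_ex; exists (\sum_i v 0 i * partial i g p).
exact: cvg_lim main.
Qed.

Lemma is_derive2_line Omega g x v (s : R) : open Omega -> Ck 2 Omega g ->
  Omega (x + s *: v) ->
  is_derive s 1 (fun h : R => \sum_i v 0 i * partial i g (x + h *: v))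
    (\sum_i v 0 i * \sum_j v 0 j * partial j (partial i g) (x + s *: v)).
Proof.
move=> oO [_ dg] Op.
rewrite (_ : (fun h => _) =
  \sum_i (fun h : R => v 0 i *: partial i g (x + h *: v))); last first.
  by apply/funext => h; rewrite fct_sumE.
apply: is_derive_sum => i; apply: is_deriveZ.
by apply: is_derive_line oO _ Op; case: (dg i).
Qed.

End Lines.

(** At the minimum [g' 0 = 0]; if [g''] were negative, [g'] would be negative just to the right of
    0, and the mean value theorem would give a value below [g 0]. *)
Lemma second_derivative_test (R : realType) (g g' : R -> R) (g'' : R) :
  (\forall s \near (0 : R), is_derive (s : R) 1 g (g' s)) -> is_derive (0 : R) 1 g' g'' ->
  (\forall s \near (0 : R), g 0 <= g s) -> 0 <= g''.
Proof.
move=> d1 d2 gmin; rewrite leNgt; apply/negP => neg.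
have [r /= r0 Hr] : exists2 r : R, 0 < r & forall s : R, `|s| < r ->
    is_derive (s : R) 1 g (g' s) /\ g 0 <= g s.
  have : \forall s \near (0 : R), is_derive (s : R) 1 g (g' s) /\ g 0 <= g s.
    by near=> s; split; near: s.
  case/nbhs_ballP => r /= r0 H.
  by exists r => // s sr; apply: H; rewrite /ball /= sub0r normrN.
have g'0 : g' 0 = 0.
  have D : is_derive (0 : R) 1 g 0.
    apply: (@derive1_at_min _ g (- r) r).
    - by rewrite ge0_cp // ltW.
    - by move=> t; rewrite in_itv /= -ltr_norml => /Hr[[]].
    - by rewrite in_itv /= oppr_lt0 r0.
    - by move=> t; rewrite in_itv /= -ltr_norml => /Hr[].
  have [|[_ <-] _] := Hr 0; first by rewrite normr0.
  by case: D.
have C : h^-1 *: ((g' \o shift 0) (h *: 1) - g' 0) @[h --> (0:R)^'] --> g''.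
  by case: d2 => c <-; exact: c.
move/cvgr_lt : C => /(_ 0 neg).
case/nbhs_ballP => q /= q0 Hq.
pose s := Num.min q r / 2.
have m0 : 0 < Num.min q r by rewrite lt_min q0 r0.
have s0 : 0 < s by rewrite /s; lra.
have [sq sr] : s < q /\ s < r.
  have : s < Num.min q r by rewrite /s; lra.
  by rewrite lt_min => /andP.
have D (t : R) : 0 <= t <= s -> is_derive t 1 g (g' t).
  move=> /andP[t0 ts]; apply: (Hr t _).1.
  by rewrite ger0_norm // (le_lt_trans ts).
have Cg : {within `[0, s], continuous g}.
  by apply: derivable_within_continuous => t; rewrite in_itv /= => /D[].
have [t] := MVT s0 (fun (t : R) (tI : t \in `]0, s[) => D t (subset_itv_oo_cc tI)) Cg.
rewrite in_itv /= subr0 => /andP[t0 ts] E.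
have : t^-1 *: ((g' \o shift 0) (t *: 1) - g' 0) < 0.
  apply: Hq; last by rewrite gt_eqF.
  by rewrite /ball /= sub0r normrN gtr0_norm // (lt_trans ts).
rewrite /= g'0 subr0 addr0 [t *: 1]mulr1 [_ *: _]mulrC pmulr_llt0 ?invr_gt0 // => g't.
have [_] := Hr s ltac:(by rewrite gtr0_norm).
rewrite -subr_ge0 E leNgt => /negP; apply.
by rewrite pmulr_llt0.
Unshelve. all: by end_near. Qed.

(** * Euclidean geometry, reflections and the closed ball *)

Section Geometry.
Context {R : realType} {n : nat}.
Implicit Types (x y e : 'rV[R]_n).

Definition dot x y : R := \sum_i x 0 i * y 0 i.

Lemma dotC x y : dot x y = dot y x.
Proof. by apply: eq_bigr => i _; rewrite mulrC. Qed.

Lemma dotDl x y e : dot (x + y) e = dot x e + dot y e.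
Proof. by rewrite -big_split; apply: eq_bigr => i _; rewrite mxE mulrDl. Qed.

Lemma dotZl (a : R) x y : dot (a *: x) y = a * dot x y.
Proof. by rewrite mulr_sumr; apply: eq_bigr => i _; rewrite mxE mulrA. Qed.

Lemma dotDr x y e : dot e (x + y) = dot e x + dot e y.
Proof. by rewrite dotC dotDl !(dotC e). Qed.

Lemma dotZr (a : R) x y : dot x (a *: y) = a * dot x y.
Proof. by rewrite dotC dotZl dotC. Qed.

Lemma dotNl x y : dot (- x) y = - dot x y.
Proof. by rewrite -scaleN1r dotZl mulN1r. Qed.

Lemma dotNr x y : dot x (- y) = - dot x y.
Proof. by rewrite dotC dotNl dotC. Qed.

Lemma dot_ge0 x : 0 <= dot x x.
Proof. by apply: sumr_ge0 => i _; rewrite -expr2 sqr_ge0. Qed.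

Lemma enormE x : enorm x = Num.sqrt (dot x x).
Proof. by rewrite /enorm; congr Num.sqrt; apply: eq_bigr => i _; rewrite expr2. Qed.

Lemma enorm_ge0 x : 0 <= enorm x.
Proof. exact: sqrtr_ge0. Qed.

Lemma sqr_enorm x : enorm x ^+ 2 = dot x x.
Proof. by rewrite enormE sqr_sqrtr // dot_ge0. Qed.

Lemma enormZ (a : R) x : enorm (a *: x) = `|a| * enorm x.
Proof. by rewrite !enormE dotZl dotZr mulrA -expr2 sqrtrM ?sqr_ge0 // sqrtr_sqr. Qed.

Lemma dot_gt0 x : x != 0 -> 0 < dot x x.
Proof.
move=> x0; rewrite lt_def dot_ge0 andbT; apply: contra x0.
rewrite psumr_eq0 => [/allP H|i _]; last by rewrite -expr2 sqr_ge0.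
by apply/eqP/rowP => i; have /H := mem_index_enum i; rewrite -expr2 sqrf_eq0 mxE => /eqP.
Qed.

Lemma enorm_gt0 x : x != 0 -> 0 < enorm x.
Proof. by move=> x0; rewrite enormE sqrtr_gt0 dot_gt0. Qed.

Lemma sqr_dot_le x e : dot e e = 1 -> dot x e ^+ 2 <= dot x x.
Proof.
move=> e1; have := dot_ge0 (x - dot x e *: e).
rewrite dotDl !dotDr !dotNl !dotNr !dotZl !dotZr e1 (dotC e x); lra.
Qed.

Lemma dot_le_enorm x e : dot e e = 1 -> dot x e <= enorm x.
Proof.
move=> e1; apply: le_trans (ler_norm _) _.
by rewrite enormE -sqrtr_sqr ler_wsqrtr // sqr_dot_le.
Qed.

Lemma unit_ballE x : unit_ball x <-> dot x x < 1.
Proof.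
by rewrite /unit_ball /= -sqr_enorm -[1 in X in _ <-> X](expr1n _ 2) ltr_pXn2r //
  ?nnegrE ?enorm_ge0.
Qed.

Lemma enorm_le1 x : (enorm x <= 1) = (dot x x <= 1).
Proof.
by rewrite -sqr_enorm -[1 in RHS](expr1n _ 2) ler_pXn2r // ?nnegrE ?enorm_ge0.
Qed.

Lemma dot_continuous (f g : 'rV[R]_n -> 'rV[R]_n) :
  continuous f -> continuous g -> continuous (fun x => dot (f x) (g x)).
Proof.
move=> cf cg x.
have Fx : Filter (nbhs x) by exact: nbhs_filter.
apply: cvg_big; first exact: add_continuous.
move=> i _.
apply: cvgM.
  exact: (continuous_comp (cf x) (@coord_continuous _ _ _ 0 i (f x))).
exact: (continuous_comp (cg x) (@coord_continuous _ _ _ 0 i (g x))).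
Qed.

Lemma dot_dir_continuous e : continuous (fun x => dot x e).
Proof.
apply: (dot_continuous (f := id) (g := fun=> e)) => y; first exact: cvg_id.
exact: cst_continuous.
Qed.

Lemma enorm_continuous : continuous (@enorm R n).
Proof.
move=> x; rewrite (_ : enorm = fun x => Num.sqrt (dot x x)); last first.
  by apply/funext => y; rewrite enormE.
apply: continuous_comp; last exact: sqrt_continuous.
by apply: (dot_continuous (f := id) (g := id)) => y; exact: cvg_id.
Qed.

(** For a unit vector [e], the reflection in the hyperplane [dot x e = l]. *)
Definition refl e (l : R) x := x + (2 * (l - dot x e)) *: e.

Lemma reflE e l x : refl e l x = x + (2 * (l - dot x e)) *: e.
Proof. by []. Qed.

Lemma refl_plane e l x : dot x e = l -> refl e l x = x.
Proof. by move=> xl; rewrite /refl xl subrr mulr0 scale0r addr0. Qed.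

(** Hence, for [l >= 0], reflecting a point with [dot x e >= l] does not increase its norm, so the
    reflected cap stays in the ball. *)
Lemma dot_refl e l x : dot e e = 1 ->
  dot (refl e l x) (refl e l x) = dot x x - 4 * l * (dot x e - l).
Proof.
move=> e1; rewrite /refl !dotDl !dotDr !dotZl !dotZr e1 (dotC e x); ring.
Qed.

Lemma refl_line e l x v (s : R) :
  refl e l (x + s *: v) = refl e l x + s *: (v - (2 * dot v e) *: e).
Proof.
rewrite /refl dotDl dotZl scalerBr -!addrA; congr (_ + _).
rewrite [RHS]addrCA; congr (_ + _); rewrite scalerA -scalerBl.
by congr (_ *: _); ring.
Qed.

Lemma refl_continuous e l : continuous (refl e l).
Proof.
move=> x; have Fx : Filter (nbhs x) := nbhs_filter x.
apply: cvgD; first exact: cvg_id.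
apply: cvgZ; last exact: cvg_cst.
apply: cvgM; first exact: cvg_cst.
apply: cvgB; first exact: cvg_cst.
exact: dot_dir_continuous.
Qed.

Lemma open_unit_ball : open (@unit_ball R n).
Proof.
rewrite (_ : unit_ball = enorm @^-1` [set r | r < 1]) //.
apply: open_comp; last exact: open_lt.
by move=> x _; exact: enorm_continuous.
Qed.

Lemma closed_cball : closed [set x : 'rV[R]_n | dot x x <= 1].
Proof.
rewrite (_ : [set _ | _] = (fun x => dot x x) @^-1` [set r | r <= 1]) //.
apply: closed_comp; last exact: closed_le.
by move=> x _; apply: (dot_continuous (f := id) (g := id)) => y; exact: cvg_id.
Qed.

Lemma coord_le_enorm x (i : 'I_n) : `|x 0 i| <= enorm x.
Proof.
rewrite enormE -sqrtr_sqr ler_wsqrtr // /dot (bigD1 i) //= -expr2 lerDl.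
by apply: sumr_ge0 => j _; rewrite -expr2 sqr_ge0.
Qed.

Lemma compact_cball : compact [set x : 'rV[R]_n | dot x x <= 1].
Proof.
apply: bounded_closed_compact; last exact: closed_cball.
exists 1; split; first exact: num_real.
move=> M M1 x /=; rewrite -enorm_le1 => x1.
rewrite /Num.norm /= mx_normrE; apply: bigmax_le; first by rewrite (le_trans _ (ltW M1)).
by move=> [j i] _ /=; rewrite (ord1 j) (le_trans (coord_le_enorm _ _)) // (le_trans x1) // ltW.
Qed.

(** A point of the closed ball is the limit of its multiples [h *: x] with [h < 1]. *)
Lemma sub_closure_unit_ball x : dot x x <= 1 -> closure unit_ball x.
Proof.
move=> x1 U Ux.
have : (fun h : R => h *: x) @ (1 : R) --> 1 *: x.
  by apply: cvgZ; [exact: cvg_id|exact: cvg_cst].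
rewrite scale1r => /(_ _ Ux) /nbhs_ballP[r /= r0 Hr].
pose h := Num.max 0 (1 - r / 2).
have h0 : 0 <= h by rewrite /h le_max lexx.
have h1 : h < 1 by rewrite /h gt_max ltr01 /= gtrBl divr_gt0.
exists (h *: x); split.
  apply/unit_ballE; rewrite dotZl dotZr mulrA -expr2.
  apply: (@le_lt_trans _ _ (h ^+ 2)); first by rewrite ler_piMr // sqr_ge0.
  by rewrite expr_lt1.
apply: Hr; rewrite /ball /= ger0_norm ?subr_ge0 ?ltW //.
rewrite ltrBlDl -ltrBlDr /h lt_max; apply/orP; right; rewrite ltrD2l ltrN2; lra.
Qed.

Lemma sphere_boundary x : dot x x = 1 -> boundary unit_ball x.
Proof.
move=> x1; split; first by apply: sub_closure_unit_ball; rewrite x1.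
by move/interior_subset/unit_ballE; rewrite x1 ltxx.
Qed.

(* Retraction onto the closed ball: [u \o clamp] is continuous everywhere and agrees with
   [u] on the closed ball. *)
Definition clamp x := (Num.max 1 (enorm x))^-1 *: x.

Lemma clamp_cball x : dot (clamp x) (clamp x) <= 1.
Proof.
rewrite -enorm_le1 /clamp enormZ ger0_norm; last by rewrite invr_ge0 le_max ler01.
by rewrite mulrC ler_pdivrMr ?mul1r ?le_max ?lexx ?orbT // lt_max ltr01.
Qed.

Lemma clamp_id x : dot x x <= 1 -> clamp x = x.
Proof. by rewrite -enorm_le1 /clamp => x1; rewrite max_l // invr1 scale1r. Qed.

Lemma clamp_continuous : continuous clamp.
Proof.
move=> x; have Fx : Filter (nbhs x) := nbhs_filter x.
apply: cvgZ; last exact: cvg_id.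
apply: cvgV; first by rewrite gt_eqF // lt_max ltr01.
apply: continuous_max; first exact: cst_continuous.
exact: enorm_continuous.
Qed.

Lemma clamp_comp_continuous (u : 'rV[R]_n -> R) :
  {within closure unit_ball, continuous u} -> continuous (u \o clamp).
Proof.
move/subspace_continuousP => cu x V /= HV.
have := cu (clamp x) (sub_closure_unit_ball (clamp_cball x)) V HV.
rewrite /within /= nbhs_simpl /= => H.
have := clamp_continuous H; rewrite !nbhs_simpl /=; apply: filterS => y /= Hy.
by apply: Hy; apply: sub_closure_unit_ball; exact: clamp_cball.
Qed.

End Geometry.

(** * The Laplacian at an interior minimum *)

Section InteriorMinimum.
Context {R : realType} {n : nat}.
Variables (u : 'rV[R]_n -> R) (p p' p'' : R -> R) (e : 'rV[R]_n) (a b l : R).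
Hypothesis u2 : Ck 2 unit_ball u.
Hypothesis e1 : dot e e = 1.
Hypothesis dp : forall s : R, is_derive s 1 p (p' s).
Hypothesis dp' : forall s : R, is_derive s 1 p' (p'' s).

(** The second derivative test is applied on each coordinate line and the results are added. The
    reflection maps the coordinate directions to the orthonormal vectors [w i], and second
    derivatives along an orthonormal basis add up to the Laplacian again. *)
Lemma interior_minimum x :
  unit_ball x -> unit_ball (refl e l x) ->
  (\forall y \near x, a * u (refl e l x) + b * u x + p (dot x e) <=
                      a * u (refl e l y) + b * u y + p (dot y e)) ->
  0 <= a * laplacian u (refl e l x) + b * laplacian u x + p'' (dot x e).
Proof.
move=> Bx BRx xmin.
pose d i : 'rV[R]_n := delta_mx 0 i.
pose w i : 'rV[R]_n := d i - (2 * e 0 i) *: e.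
have dE i y : dot y (d i) = y 0 i.
  rewrite /dot (bigD1 i) //= mxE !eqxx mulr1 big1 ?addr0 // => j ji.
  by rewrite mxE eqxx (negbTE ji) mulr0.
have line i (s : R) : refl e l (x + s *: d i) = refl e l x + s *: w i.
  by rewrite refl_line dotC dE.
have oB := @open_unit_ball R n.
have u1 : Ck 1 unit_ball u.
  by case: u2 => cu du; split=> // i; case: (du i) => H [? _]; split.
have test i :
    0 <= a * (\sum_j w i 0 j * \sum_k w i 0 k * partial k (partial j u) (refl e l x))
      + b * (\sum_j d i 0 j * \sum_k d i 0 k * partial k (partial j u) x)
      + e 0 i * (e 0 i * p'' (dot x e)).
  pose g (s : R) := a * u (refl e l x + s *: w i) + b * u (x + s *: d i)
    + p (dot x e + s * e 0 i).
  pose g' (s : R) := a * (\sum_j w i 0 j * partial j u (refl e l x + s *: w i))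
    + b * (\sum_j d i 0 j * partial j u (x + s *: d i)) + e 0 i * p' (dot x e + s * e 0 i).
  have near_line (y v : 'rV[R]_n) : unit_ball y ->
      \forall s \near (0 : R), unit_ball (y + s *: v).
    move=> By.
    have : (fun s : R => y + s *: v) @ 0 --> y + 0 *: v.
      by apply: cvgD; [exact: cvg_cst|apply: cvgZ; [exact: cvg_id|exact: cvg_cst]].
    rewrite scale0r addr0 => H; apply: (H unit_ball).
    by apply: open_nbhs_nbhs; split.
  have affine (s : R) : is_derive s 1 (fun s : R => dot x e + s * e 0 i) (e 0 i).
    by apply: is_derive_eq; rewrite add0r mul1r scaler0 add0r [_%:A]mulr1.
  have compd (q q' : R -> R) (s : R) : (forall t : R, is_derive t 1 q (q' t)) ->
     is_derive s 1 (fun s : R => q (dot x e + s * e 0 i)) (e 0 i * q' (dot x e + s * e 0 i)).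
    move=> dq; have := @is_derive1_comp _ _ _ s _ _ (dq _) (affine s).
    by move=> H; apply: is_derive_eq H _; rewrite mulrC.
  apply: (@second_derivative_test _ g g').
  - near=> s.
    have D1 : is_derive s 1 (fun h : R => u (refl e l x + h *: w i))
        (\sum_j w i 0 j * partial j u (refl e l x + s *: w i)).
      by apply: is_derive_line oB u1 _; near: s; exact: near_line.
    have D2 : is_derive s 1 (fun h : R => u (x + h *: d i))
        (\sum_j d i 0 j * partial j u (x + s *: d i)).
      by apply: is_derive_line oB u1 _; near: s; exact: near_line.
    have D3 := compd _ _ s dp.
    have := is_deriveD (is_deriveD (is_deriveZ a D1) (is_deriveZ b D2)) D3.
    exact.
  - have D1 := @is_derive2_line _ _ _ u (refl e l x) (w i) 0 oB u2.
    rewrite scale0r addr0 in D1; have {}D1 := D1 BRx.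
    have D2 := @is_derive2_line _ _ _ u x (d i) 0 oB u2.
    rewrite scale0r addr0 in D2; have {}D2 := D2 Bx.
    have D3 := is_deriveZ (e 0 i) (compd _ _ 0 dp'); rewrite mul0r addr0 in D3.
    have := is_deriveD (is_deriveD (is_deriveZ a D1) (is_deriveZ b D2)) D3.
    exact.
  - have : (fun s : R => x + s *: d i) @ 0 --> x + 0 *: d i.
      by apply: cvgD; [exact: cvg_cst|apply: cvgZ; [exact: cvg_id|exact: cvg_cst]].
    rewrite scale0r addr0 => H.
    have {}H : \forall s \near (0 : R), a * u (refl e l x) + b * u x + p (dot x e) <=
      a * u (refl e l (x + s *: d i)) + b * u (x + s *: d i)
        + p (dot (x + s *: d i) e) := H _ xmin.
    apply: filterS H => s.
    by rewrite line /g !scale0r mul0r !addr0 dotDl dotZl (dotC (d i)) dE.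
have sum3 (X Y Z : 'I_n -> R) : \sum_i (a * X i + b * Y i + Z i) =
    a * (\sum_i X i) + b * (\sum_i Y i) + \sum_i Z i.
  by rewrite 2!big_split /= -2!mulr_sumr.
have sumd i (F : 'I_n -> R) : \sum_j d i 0 j * F j = F i.
  rewrite (bigD1 i) //= mxE !eqxx mul1r big1 ?addr0 // => j ji.
  by rewrite mxE eqxx (negbTE ji) mul0r.
have wE i m : w i 0 m = d m 0 i - 2 * e 0 i * e 0 m.
  by rewrite /w /d !mxE eqxx /= [m == i]eq_sym.
(* The [w i] are the columns of the orthogonal matrix [1 - 2 e e^T], using [dot e e = 1]. *)
have orth j k : \sum_i w i 0 j * w i 0 k = (j == k)%:R.
  transitivity (\sum_i (d j 0 i * (d k 0 i - 2 * e 0 k * e 0 i)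
     + (- (2 * e 0 j)) * (d k 0 i * e 0 i) + (4 * e 0 j * e 0 k) * (e 0 i * e 0 i))).
    by apply: eq_bigr => i _; rewrite !wE; ring.
  rewrite 2!big_split /= -2!mulr_sumr !sumd -/(dot e e) e1 /d mxE eqxx /=.
  by rewrite eq_sym; ring.
have orthF (F : 'I_n -> 'I_n -> R) :
    \sum_i \sum_j w i 0 j * \sum_k w i 0 k * F k j = \sum_j F j j.
  rewrite exchange_big /=; apply: eq_bigr => j _.
  transitivity (\sum_k (j == k)%:R * F k j).
    transitivity (\sum_i \sum_k (w i 0 j * w i 0 k) * F k j).
      by apply: eq_bigr => i _; rewrite mulr_sumr; apply: eq_bigr => k _; rewrite mulrA.
    by rewrite exchange_big /=; apply: eq_bigr => k _; rewrite -mulr_suml orth.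
  rewrite (bigD1 j) //= eqxx mul1r big1 ?addr0 // => k kj.
  by rewrite eq_sym (negbTE kj) mul0r.
have HX := orthF (fun k j => partial k (partial j u) (refl e l x)).
have HY : \sum_i (\sum_j d i 0 j * \sum_k d i 0 k * partial k (partial j u) x) = laplacian u x.
  by apply: eq_bigr => i _; rewrite sumd; exact: sumd.
have HZ : \sum_i e 0 i * (e 0 i * p'' (dot x e)) = p'' (dot x e).
  transitivity (dot e e * p'' (dot x e)); last by rewrite e1 mul1r.
  by rewrite mulr_suml; apply: eq_bigr => i _; rewrite mulrA.
rewrite -[laplacian u (refl e l x)]HX -[laplacian u x]HY -[p'' _]HZ -sum3.
by apply: sumr_ge0 => i _; exact: test.
Unshelve. all: by end_near. Qed.

End InteriorMinimum.

(** * One-dimensional barriers *)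

Section Barrier.
Context {R : realType}.
Variables (c0 c1 c2 c3 b : R).

(* A single family containing all the one-dimensional barriers of the proof. *)
Definition barrier (t : R) := c0 + c1 * t + c2 * t ^+ 2 + c3 * expR (b * t).

Lemma is_derive_barrier (l s : R) :
  is_derive s 1 (fun s => barrier (s - l))
    (c1 + 2 * c2 * (s - l) + c3 * b * expR (b * (s - l))).
Proof.
have D1 : is_derive s 1 (fun s : R => s - l) 1.
  by have := is_deriveB (is_derive_id s (1 : R)) (is_derive_cst l s (1 : R)); rewrite subr0.
have D2 : is_derive s 1 (fun s : R => b * (s - l)) b.
  by have := is_deriveZ b D1; rewrite [_ *: 1]mulr1.
have D3 := @is_derive1_comp _ expR (fun s : R => b * (s - l)) s _ _ (is_derive_expR _) D2.
have D4 : is_derive s 1 (fun s : R => (s - l) ^+ 2) (2 * (s - l)).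
  rewrite (_ : (fun s => _) = (fun s : R => s - l) * (fun s : R => s - l)); last first.
    by apply/funext => t; rewrite expr2.
  apply: is_derive_eq (is_deriveM D1 D1) _; rewrite /GRing.scale /=; ring.
have H := is_deriveD (is_deriveD (is_deriveD (is_derive_cst c0 s 1) (is_deriveZ c1 D1))
  (is_deriveZ c2 D4)) (is_deriveZ c3 D3).
by apply: is_derive_eq H _; rewrite /GRing.scale /=; ring.
Qed.

Lemma is_derive_barrier' (l s : R) :
  is_derive s 1 (fun s => c1 + 2 * c2 * (s - l) + c3 * b * expR (b * (s - l)))
    (2 * c2 + c3 * b ^+ 2 * expR (b * (s - l))).
Proof.
have D1 : is_derive s 1 (fun s : R => s - l) 1.
  by have := is_deriveB (is_derive_id s (1 : R)) (is_derive_cst l s (1 : R)); rewrite subr0.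
have D2 : is_derive s 1 (fun s : R => b * (s - l)) b.
  by have := is_deriveZ b D1; rewrite [_ *: 1]mulr1.
have D3 := @is_derive1_comp _ expR (fun s : R => b * (s - l)) s _ _ (is_derive_expR _) D2.
have H := is_deriveD (is_deriveD (is_derive_cst c1 s 1) (is_deriveZ (2 * c2) D1))
  (is_deriveZ (c3 * b) D3).
by apply: is_derive_eq H _; rewrite /GRing.scale /=; ring.
Qed.

Lemma barrier_continuous : continuous barrier.
Proof.
move=> t; have D := is_derive_barrier 0 t.
have /derivable1_diffP/differentiable_continuous : derivable barrier t 1.
  by case: D => D _; move: D; under eq_fun do rewrite subr0.
exact.
Qed.

End Barrier.

(** * The comparison principle on a cap *)

Section Comparison.
Context {R : realType} {n : nat}.
Variables (u : 'rV[R]_n -> R) (e : 'rV[R]_n).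
Hypothesis u2 : Ck 2 unit_ball u.
Hypothesis uc : {within closure unit_ball, continuous u}.
Hypothesis e1 : dot e e = 1.

Lemma ball_minimum (D : set 'rV[R]_n) (v : 'rV[R]_n -> R) :
  closed D -> (forall x, D x -> dot x x <= 1) -> D !=set0 -> continuous v ->
  exists2 c, D c & forall x, D x -> v c <= v x.
Proof.
move=> cD Dball D0 cv.
have kD : compact D by exact: subclosed_compact cD (@compact_cball R n) Dball.
have [c cin cmin] := compact_EVT_min D0 kD (continuous_subspaceT cv).
by exists c; [rewrite inE in cin|move=> x Dx; apply: cmin; rewrite inE].
Qed.

Lemma closed_dot_ge (m : R) : closed [set x : 'rV[R]_n | m <= dot x e].
Proof.
rewrite (_ : [set _ | _] = (fun x => dot x e) @^-1` [set r | m <= r]) //.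
apply: closed_comp; last exact: closed_ge.
by move=> x _; exact: dot_dir_continuous.
Qed.

Lemma closed_dot_le (m : R) : closed [set x : 'rV[R]_n | dot x e <= m].
Proof.
rewrite (_ : [set _ | _] = (fun x => dot x e) @^-1` [set r | r <= m]) //.
apply: closed_comp; last exact: closed_le.
by move=> x _; exact: dot_dir_continuous.
Qed.

Variables (l : R).

(** With [a = 1], [b = -1] this is w_l plus a barrier; with [a = -1], [b = 1] it is a barrier minus
    w_l; with [a = 0], [b = -1] it is a barrier minus [u]. One comparison lemma serves all three. *)
Definition excess (a b c0 c1 c2 c3 k : R) (x : 'rV[R]_n) :=
  a * u (refl e l x) + b * u x + barrier c0 c1 c2 c3 k (dot x e - l).

Lemma near_inside (x : 'rV[R]_n) (m : R) : dot x x < 1 -> m < dot x e ->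
  \forall y \near x, dot y y < 1 /\ m < dot y e.
Proof.
move=> Bx mx; have Fx : Filter (nbhs x) := nbhs_filter x.
have H1 : \forall y \near x, unit_ball y.
  by apply: open_nbhs_nbhs; split; [exact: open_unit_ball|apply/unit_ballE].
have H2 : \forall y \near x, m < dot y e.
  by move/cvgr_gt : (@dot_dir_continuous R n e x); exact.
by apply: filterS2 H1 H2 => y /unit_ballE.
Qed.

(** Composing with [clamp] gives a function continuous on the whole space, so its minimum on a
    compact cap exists; [ext_excessE] identifies it with [excess] there. *)
Lemma ext_excess_continuous (a b c0 c1 c2 c3 k : R) :
  continuous (fun x => a * (u \o clamp) (refl e l x) + b * (u \o clamp) x
     + barrier c0 c1 c2 c3 k (dot x e - l)).
Proof.
have cu := clamp_comp_continuous uc.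
move=> x; have Fx : Filter (nbhs x) := nbhs_filter x.
apply: cvgD; last first.
  apply: (@continuous_comp _ _ _ (fun x => dot x e - l) (barrier c0 c1 c2 c3 k)).
    by apply: cvgB; [exact: dot_dir_continuous|exact: cvg_cst].
  exact: barrier_continuous.
apply: cvgD; apply: cvgM; try exact: cvg_cst.
  apply: (@continuous_comp _ _ _ (refl e l) (u \o clamp)); last exact: cu.
  exact: refl_continuous.
exact: cu.
Qed.

(** The hypothesis is a product so that for [l = 0] it holds on both sides of the plane, as
    [boundary_bound] requires. *)
Lemma refl_inside (x : 'rV[R]_n) : 0 <= l * (dot x e - l) ->
  dot (refl e l x) (refl e l x) <= dot x x.
Proof. by move=> h; rewrite dot_refl //; lra. Qed.

Lemma ext_excessE (a b c0 c1 c2 c3 k : R) (x : 'rV[R]_n) :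
  dot x x <= 1 -> 0 <= l * (dot x e - l) ->
  a * (u \o clamp) (refl e l x) + b * (u \o clamp) x + barrier c0 c1 c2 c3 k (dot x e - l)
  = excess a b c0 c1 c2 c3 k x.
Proof.
move=> x1 lx; rewrite /excess /= !clamp_id //.
by apply: le_trans x1; exact: refl_inside.
Qed.

Lemma excess_minimum (a b c0 c1 c2 c3 k : R) (x : 'rV[R]_n) :
  dot x x < 1 -> 0 <= l * (dot x e - l) ->
  (\forall y \near x, excess a b c0 c1 c2 c3 k x <= excess a b c0 c1 c2 c3 k y) ->
  0 <= a * laplacian u (refl e l x) + b * laplacian u x +
       (2 * c2 + c3 * k ^+ 2 * expR (k * (dot x e - l))).
Proof.
move=> Bx lx xmin.
apply: (@interior_minimum _ _ u (fun s => barrier c0 c1 c2 c3 k (s - l)) _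
  (fun s => 2 * c2 + c3 * k ^+ 2 * expR (k * (s - l))) e a b l u2 e1
  (is_derive_barrier c0 c1 c2 c3 k l) (is_derive_barrier' c1 c2 c3 k l)) => //.
  exact/unit_ballE.
by apply/unit_ballE; apply: le_lt_trans Bx; exact: refl_inside.
Qed.

(** A negative minimum of [F] would be attained inside the cap, where [excess_minimum] contradicts
    the strict inequality. That inequality is asked only where [F x < 0], so the sign of [F] may be
    used to bound the zeroth-order term. *)
Lemma comparison (a b c0 c1 c2 c3 k m : R) :
  let F := excess a b c0 c1 c2 c3 k in
  (forall s, m <= s -> 0 <= l * (s - l)) ->
  (forall x, dot x x = 1 -> m <= dot x e -> 0 <= F x) ->
  (forall x, dot x x <= 1 -> dot x e = m -> 0 <= F x) ->
  (forall x, dot x x < 1 -> m < dot x e -> F x < 0 ->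
     a * laplacian u (refl e l x) + b * laplacian u x +
       (2 * c2 + c3 * k ^+ 2 * expR (k * (dot x e - l))) < 0) ->
  forall x, dot x x <= 1 -> m <= dot x e -> 0 <= F x.
Proof.
move=> F lm Fsphere Fplane Flap x x1 mx; rewrite leNgt; apply/negP => Fx.
pose D := [set x : 'rV[R]_n | dot x x <= 1] `&` [set x | m <= dot x e].
have cD : closed D by apply: closedI; [exact: closed_cball|exact: closed_dot_ge].
have D0 : D !=set0 by exists x.
have [c [c1' mc] cmin] := ball_minimum cD (fun x (Dx : D x) => Dx.1) D0
  (@ext_excess_continuous a b c0 c1 c2 c3 k).
have {}cmin y : D y -> F c <= F y.
  move=> Dy; have := cmin y Dy; rewrite !ext_excessE //.
  - exact: Dy.1.
  - exact: lm Dy.2.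
  - exact: lm.
have Fc : F c < 0 by apply: le_lt_trans Fx; exact: cmin.
have Bc : dot c c < 1.
  rewrite lt_neqAle c1' andbT; apply/eqP => cc; move: Fc; rewrite ltNge => /negP; apply.
  exact: Fsphere.
have mc' : m < dot c e.
  rewrite lt_neqAle mc andbT; apply/eqP => cc; move: Fc; rewrite ltNge => /negP; apply.
  exact: Fplane.
have := Flap c Bc mc' Fc; apply/negP; rewrite -leNgt.
apply: excess_minimum => //; first exact: lm.
apply: filterS (near_inside Bc mc') => y [y1 y2].
by apply: cmin; split; exact: ltW.
Qed.

End Comparison.

(** * Distances and the reflection exchanging two points *)

Section Distances.
Context {R : realType} {n : nat}.
Implicit Types (x y z e : 'rV[R]_n).

Lemma enormN x : enorm (- x) = enorm x.
Proof. by rewrite !enormE dotNl dotNr opprK. Qed.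

Lemma unit_normalize x : x != 0 -> dot ((enorm x)^-1 *: x) ((enorm x)^-1 *: x) = 1.
Proof.
move=> x0; have nx := enorm_gt0 x0.
by rewrite dotZl dotZr -sqr_enorm; field; rewrite gt_eqF.
Qed.

Lemma cauchy_schwarz x y : dot x y <= enorm x * enorm y.
Proof.
have [->|y0] := eqVneq y 0.
  by rewrite -(scale0r (0 : 'rV[R]_n)) dotZr mul0r mulr_ge0 // enorm_ge0.
have ny := enorm_gt0 y0.
have := dot_le_enorm x (unit_normalize y0).
by rewrite dotZr -ler_pdivlMl ?invr_gt0 // invrK mulrC.
Qed.

Lemma enormB_le x y : enorm (x - y) <= enorm x + enorm y.
Proof.
rewrite -(ler_pXn2r (n := 2)) // ?nnegrE ?addr_ge0 ?enorm_ge0 // sqrrD !sqr_enorm.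
rewrite dotDl !dotDr !dotNl !dotNr opprK (dotC y x).
have := cauchy_schwarz (- x) y; rewrite dotNl enormN; lra.
Qed.

(** The plane is the perpendicular bisector, with [e] the direction of [x - z]. Comparing [u] at two
    points thus becomes a statement on some w_l, with [l >= 0] when [z] is no farther from the
    origin than [x]. *)
Lemma reflection_pair x z : x != z ->
  exists e l, [/\ dot e e = 1, refl e l x = z, dot x e - l = enorm (x - z) / 2 &
    l = (dot x x - dot z z) / (2 * enorm (x - z))].
Proof.
rewrite -subr_eq0 => xz; have d0 := enorm_gt0 xz; set d := enorm (x - z) in d0 *.
have dn : d != 0 by rewrite gt_eqF.
have dd : dot x x - 2 * dot x z + dot z z = d ^+ 2.
  by rewrite sqr_enorm dotDl !dotDr !dotNl !dotNr (dotC z x); ring.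
exists (d^-1 *: (x - z)), ((dot x x - dot z z) / (2 * d)).
have h : dot x (d^-1 *: (x - z)) - (dot x x - dot z z) / (2 * d) = d / 2.
  rewrite dotZr dotDr dotNr.
  transitivity ((dot x x - 2 * dot x z + dot z z) / (2 * d)); first by field.
  by rewrite dd; field.
split=> //; first exact: unit_normalize.
rewrite reflE -opprB h scalerA (_ : 2 * - (d / 2) / d = -1); last by field.
by rewrite scaleN1r opprB addrCA subrr addr0.
Qed.

Lemma refl_line_dir e x (s : R) : dot e e = 1 -> refl e (dot x e) (x + s *: e) = x - s *: e.
Proof.
move=> e1; rewrite refl_line refl_plane // e1 mulr1.
rewrite -[X in _ *: (X - _)]scale1r -scalerBl scalerA.
by rewrite (_ : s * (1 - 2) = - s) ?scaleNr //; ring.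
Qed.

End Distances.

(** From [1 - y <= exp (- y)] one gets [exp y - 1 <= y * exp y], applied at [y = b * t <= b]. *)
Lemma expR_sub1_le (R : realType) (b t : R) : 0 <= b -> 0 <= t <= 1 ->
  expR (b * t) - 1 <= b * expR b * t.
Proof.
move=> b0 /andP[t0 t1].
have h1 : expR (b * t) * (1 - b * t) <= 1.
  rewrite -[leRHS](expR0) -(subrr (b * t)) expRD ler_pM2l ?expR_gt0 //.
  exact: expR_ge1Dx.
have h2 : expR (b * t) <= expR b by rewrite ler_expR ler_piMr.
have h3 : b * t * expR (b * t) <= b * t * expR b by rewrite ler_wpM2l ?mulr_ge0.
lra.
Qed.

(** Here [W] stands for |w_l|, [E] for [exp (B t)] with [B = Lam + 1], and [c] for [2 * L * eps].
    The right side is the second derivative in [t] of [A * exp (B t) + m * B * t^2]; the case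
    [m = 0] serves the cap, [m > 0] the narrow strip. *)
Lemma subsolution_inequality (R : realType) (Lam m A c E t W : R) :
  0 <= Lam -> 0 <= m -> 0 <= c -> c < A -> 1 <= E -> 0 <= t <= 1 ->
  W <= A * (E - 1) + m ->
  Lam * W + c * t < 2 * m * (Lam + 1) + A * (Lam + 1) ^+ 2 * E.
Proof.
move=> Lam0 m0 c0 cA E1 /andP[t0 t1] WA.
have A0 : 0 < A by lra.
have h1 := ler_wpM2l Lam0 WA.
have h2 : c * t <= c by rewrite ler_piMr.
have h3 : 0 <= Lam * m by rewrite mulr_ge0.
have h4 : A <= A * E by rewrite ler_peMr // ltW.
have h5 : 0 <= A * Lam * E by rewrite !mulr_ge0 //; lra.
have h6 : 0 <= A * Lam ^+ 2 * E by rewrite !mulr_ge0 ?sqr_ge0 //; lra.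
have h7 : 0 <= Lam * A by rewrite mulr_ge0 // ltW.
lra.
Qed.

(** The centered difference has derivative [2 * D] at 0. Centered differences are what the
    reflection in the plane through [x] orthogonal to [e] provides. *)
Lemma centered_derivative_le (R : realType) (n : nat) (g : 'rV[R]_n -> R)
    (x e : 'rV[R]_n) (c r : R) :
  Ck 1 unit_ball g -> unit_ball x -> 0 < r ->
  (forall s, 0 < s < r -> g (x + s *: e) - g (x - s *: e) <= 2 * c * s) ->
  \sum_i e 0 i * partial i g x <= c.
Proof.
move=> g1 Bx r0 gc; set D := \sum_i _; rewrite leNgt; apply/negP => cD.
have Bx0 : unit_ball (x + (0 : R) *: e) by rewrite scale0r addr0.
have D1 := is_derive_line (@open_unit_ball R n) g1 Bx0.
have Bx0' : unit_ball (x + (0 : R) *: - e) by rewrite scale0r addr0.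
have D2 := is_derive_line (@open_unit_ball R n) g1 Bx0'.
rewrite !scale0r !addr0 in D1 D2.
have [ex D3] := is_deriveB D1 D2.
pose G := (fun h : R => g (x + h *: e)) - (fun h : R => g (x + h *: - e)).
have C : (fun h : R => h^-1 *: ((G \o shift 0) (h *: 1) - G 0)) @ 0^' --> 2 * D.
  have -> : 2 * D = D - \sum_i (- e) 0 i * partial i g x.
    rewrite /D -sumrB mulr_sumr; apply: eq_bigr => i _; rewrite mxE; ring.
  by rewrite -D3; exact: ex.
move/cvgr_gt : C => /(_ (2 * c)); rewrite ltr_pM2l // => /(_ cD).
case/nbhs_ballP => q /= q0 Hq.
pose s := Num.min q r / 2.
have m0 : 0 < Num.min q r by rewrite lt_min q0 r0.
have s0 : 0 < s by rewrite /s; lra.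
have [sq sr] : s < q /\ s < r.
  have : s < Num.min q r by rewrite /s; lra.
  by rewrite lt_min => /andP.
have : 2 * c < s^-1 * (g (x + s *: e) - g (x - s *: e)).
  have := Hq s; rewrite /ball /= sub0r normrN gtr0_norm // => /(_ sq).
  rewrite gt_eqF // => /(_ isT).
  rewrite addr0 [s *: 1]mulr1.
  have GE (h : R) : G h = g (x + h *: e) - g (x + h *: - e) by [].
  by rewrite !GE !scale0r subrr subr0 scalerN.
by rewrite ltr_pdivlMl // mulrC ltNge gc // s0.
Qed.

(** * Moving planes: the equation and its constants *)

Section MovingPlanes.
Context {R : realType} {n : nat}.
Variables (u kappa : 'rV[R]_n -> R) (f : R -> R) (K L C0 eps : R).
Hypothesis K0 : 0 <= K.
Hypothesis L0 : 0 <= L.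
Hypothesis eps0 : 0 <= eps.
Hypothesis C01 : 1 <= C0.
Hypothesis u2 : Ck 2 unit_ball u.
Hypothesis uc : {within closure unit_ball, continuous u}.
Hypothesis eqn : forall x, unit_ball x -> - laplacian u x = kappa x * f (u x).
Hypothesis upos : forall x, unit_ball x -> 0 < u x.
Hypothesis usphere : forall x, dot x x = 1 -> u x = 0.
Hypothesis ulow : forall x, unit_ball x -> C0^-1 * (1 - enorm x) <= u x.
Hypothesis uup : forall x, unit_ball x -> u x <= C0.
Hypothesis kappa_bound : forall x, unit_ball x -> 0 <= kappa x <= K.
Hypothesis kappa_lip : forall x e (s : R), dot e e = 1 -> unit_ball x ->
  unit_ball (x + s *: e) -> `|kappa (x + s *: e) - kappa x| <= eps * `|s|.
Hypothesis f_bound : forall t, 0 <= t <= C0 -> `|f t| <= L.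
Hypothesis f_lip : forall s t, 0 <= s <= C0 -> 0 <= t <= C0 ->
  `|f s - f t| <= L * `|s - t|.

(** [Lam] bounds both the Laplacian of [u] and the zeroth-order coefficient in the equation of w_l;
    [B] exceeds it by 1 to make the barrier inequalities strict. *)
Let Lam := K * L.
Let B := Lam + 1.

Lemma Lam_ge0 : 0 <= Lam. Proof. exact: mulr_ge0. Qed.

Lemma B_ge0 : 0 <= B. Proof. by rewrite /B addr_ge0 // Lam_ge0. Qed.

Lemma u_range x : unit_ball x -> 0 <= u x <= C0.
Proof. by move=> Bx; rewrite ltW ?upos //= uup. Qed.

Lemma laplacian_bound x : unit_ball x -> `|laplacian u x| <= Lam.
Proof.
move=> Bx; rewrite -normrN eqn // normrM; have /andP[k0 kK] := kappa_bound Bx.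
by rewrite (ger0_norm k0) ler_pM // f_bound // u_range.
Qed.

Lemma laplacian_range x : unit_ball x -> -Lam <= laplacian u x <= Lam.
Proof. by move=> Bx; rewrite -ler_norml; exact: laplacian_bound. Qed.

Lemma u_closed_ge0 x : dot x x <= 1 -> 0 <= u x.
Proof.
rewrite le_eqVlt => /orP[/eqP/usphere ->//|x1].
by apply/ltW/upos/unit_ballE.
Qed.

(** * The equation of w_l and a first boundary bound *)

Section Direction.
Variables (e : 'rV[R]_n) (l : R).
Hypothesis e1 : dot e e = 1.
Hypothesis l0 : 0 <= l.

Let w x := u (refl e l x) - u x.
Let t x := dot x e - l.

Lemma refl_ball x : 0 <= t x -> unit_ball x -> unit_ball (refl e l x).
Proof.
move=> tx /unit_ballE Bx; apply/unit_ballE; apply: le_lt_trans Bx.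
by apply: refl_inside => //; exact: mulr_ge0.
Qed.

Lemma refl_closed x : 0 <= t x -> dot x x <= 1 -> dot (refl e l x) (refl e l x) <= 1.
Proof.
move=> tx Bx; apply: le_trans Bx.
by apply: refl_inside => //; exact: mulr_ge0.
Qed.

(** The difference of the right-hand sides is split into a change of [f] at fixed [kappa] and a
    change of [kappa] at fixed [f]; the latter is over the distance [2 * t x] between the point and
    its reflection. *)
Lemma laplacian_difference x : unit_ball x -> 0 <= t x ->
  `|laplacian u (refl e l x) - laplacian u x| <= Lam * `|w x| + 2 * L * eps * t x.
Proof.
move=> Bx tx; have BRx := refl_ball tx Bx.
have -> : laplacian u (refl e l x) - laplacian u x =
   kappa x * (f (u x) - f (u (refl e l x)))
   + (kappa x - kappa (refl e l x)) * f (u (refl e l x)).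
  move: (eqn Bx) (eqn BRx); move: (laplacian u x) (laplacian u (refl e l x)) => p q.
  move: (f (u x)) (f (u (refl e l x))) => f1 f2; lra.
apply: (le_trans (ler_normD _ _)); apply: lerD.
  rewrite normrM; have /andP[k0 kK] := kappa_bound Bx.
  rewrite (ger0_norm k0) /Lam -mulrA ler_pM // /w distrC.
  by apply: f_lip; exact: u_range.
rewrite normrM (_ : _ * _ * t x = (eps * (2 * t x)) * L); last by ring.
apply: ler_pM => //; last by apply: f_bound; exact: u_range.
rewrite distrC; rewrite reflE in BRx *; apply: le_trans (kappa_lip e1 Bx BRx) _.
rewrite (_ : 2 * (l - dot x e) = - (2 * t x)); last by rewrite /t; ring.
by rewrite normrN ger0_norm // mulr_ge0.
Qed.

Lemma laplacian_difference_ge x : unit_ball x -> 0 <= t x ->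
  laplacian u (refl e l x) - laplacian u x <= Lam * `|w x| + 2 * L * eps * t x.
Proof. by move=> Bx tx; apply: le_trans (laplacian_difference Bx tx); exact: ler_norm. Qed.

Lemma dot_dir_le1 x : dot x x <= 1 -> -1 <= dot x e <= 1.
Proof.
move=> x1; rewrite -ler_norml -(expr_le1 (n := 2)) // real_normK ?num_real //.
exact: le_trans (sqr_dot_le x e1) x1.
Qed.

(** As a function of [s = dot x e], the right side is nonnegative for [-1 <= s <= 1], vanishes at
    [s = 1] and has second derivative [- 2 * B], below [- Lam]. *)
Lemma boundary_bound x : dot x x <= 1 -> u x <= B * (1 - dot x e) * (3 + dot x e).
Proof.
move=> x1; have Lam0 := Lam_ge0.
(* Taking [a = 0] removes the reflected term, and [m = -1] makes the cap the whole ball. *)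
have := @comparison _ _ u e u2 uc e1 0 0 (-1) (3 * B) (- 2 * B) (- B) 0 0 (-1).
rewrite /excess /barrier.
move=> /(_ _ _ _ _ x x1) H.
suff : 0 <= 0 * u (refl e 0 x) + -1 * u x + (3 * B + - 2 * B * (dot x e - 0)
  + - B * (dot x e - 0) ^+ 2 + 0 * expR (0 * (dot x e - 0))).
  rewrite subr0; lra.
apply: H; last by have /andP[] := dot_dir_le1 x1.
- by move=> s _; rewrite mul0r.
- move=> y y1 _; rewrite (usphere y1) subr0.
  have /andP[y2 y3] : -1 <= dot y e <= 1 by apply: dot_dir_le1; rewrite y1.
  have : 0 <= B * ((1 - dot y e) * (3 + dot y e)).
    by rewrite !mulr_ge0 /B //; lra.
  lra.
- move=> y y1 y2; have yy : dot y y = 1.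
    by apply/eqP; rewrite eq_le y1 /=; have := sqr_dot_le y e1; rewrite y2 sqrrN expr1n.
  by rewrite (usphere yy) subr0 y2 /B; lra.
- move=> y /unit_ballE By _ _; have /andP[h1 _] := laplacian_range By.
  rewrite /B.
  by move: (laplacian u y) h1 => p; lra.
Qed.

End Direction.

(** * Quadratic barriers for a fixed plane *)

Section Plane.
Variables (e : 'rV[R]_n) (l : R).
Hypothesis e1 : dot e e = 1.
Hypothesis l0 : 0 <= l.

Let w x := u (refl e l x) - u x.
Let t x := dot x e - l.

Lemma t_le1 x : dot x x <= 1 -> t x <= 1.
Proof. by move=> /(dot_dir_le1 e1)/andP[_ h]; move: l0; rewrite /t; lra. Qed.

(** [boundary_bound] is used in the direction of [x] itself: with [y] the reflected point,
    [1 - dot y x <= 2 * t x], and the other factor [3 + dot y x] is at most 4. *)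
Lemma sphere_upper x : dot x x = 1 -> 0 <= t x -> u (refl e l x) <= 8 * B * t x.
Proof.
move=> x1 tx; have Lam0 := Lam_ge0.
have R1 : dot (refl e l x) (refl e l x) <= 1 by apply: refl_closed => //; rewrite x1.
have := boundary_bound x1 R1.
have E : dot (refl e l x) x = 1 - 2 * t x * dot e x.
  by rewrite reflE dotDl dotZl x1 /t; ring.
have /andP[h1 h2] := dot_dir_le1 x1 R1.
have /andP[h3 h4] : -1 <= dot x e <= 1 by apply: dot_dir_le1 => //; rewrite x1.
move=> /le_trans; apply.
have a1 : 1 - dot (refl e l x) x <= 2 * t x.
  rewrite E dotC; have : 0 <= t x * (1 - dot x e) by rewrite mulr_ge0 // subr_ge0.
  lra.
have a2 : (1 - dot (refl e l x) x) * (3 + dot (refl e l x) x) <= (2 * t x) * 4.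
  by apply: ler_pM => //; lra.
have : B * ((1 - dot (refl e l x) x) * (3 + dot (refl e l x) x)) <= B * ((2 * t x) * 4).
  by apply: ler_wpM2l => //; rewrite /B; lra.
lra.
Qed.

(** The reflected point [y] has [|y|^2 = 1 - 4 l t], and [1 - |y| >= (1 - |y|^2) / 2]. The case
    [t = 0] is apart because the lower bound on [u] is assumed only in the open ball. *)
Lemma sphere_lower x : dot x x = 1 -> 0 < l -> 0 <= t x -> 2 * l / C0 * t x <= u (refl e l x).
Proof.
move=> x1 l0' tx; have := tx; rewrite le_eqVlt => /orP[/eqP <-|tx'].
  by rewrite mulr0; apply: u_closed_ge0; apply: refl_closed => //; rewrite x1.
have E : dot (refl e l x) (refl e l x) = 1 - 4 * l * t x by rewrite dot_refl // x1.
have BR : unit_ball (refl e l x) by apply/unit_ballE; rewrite E; have := mulr_gt0 l0' tx'; lra.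
apply: le_trans (ulow BR).
rewrite (_ : 2 * l / C0 * t x = C0^-1 * (2 * l * t x)); last by ring.
apply: ler_wpM2l; first by rewrite invr_ge0 (le_trans _ C01).
have := sqr_enorm (refl e l x); rewrite E.
have := sqr_ge0 (enorm (refl e l x) - 1); lra.
Qed.

Lemma reflection_upper x : dot x x <= 1 -> 0 <= t x -> w x <= 9 * B * t x.
Proof.
move=> x1 tx; have Lam0 := Lam_ge0.
(* The barrier is [9 B t - B t^2]: its second derivative [- 2 * B] absorbs the two Laplacians, and
   on the sphere [t <= 1] leaves the [8 B t] of [sphere_upper]. *)
have := @comparison _ _ u e u2 uc e1 l (-1) 1 0 (9 * B) (- B) 0 0 l.
rewrite /excess /barrier.
move=> /(_ _ _ _ _ x x1) H.
have tx0 := tx.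
suff : 0 <= -1 * u (refl e l x) + 1 * u x + (0 + 9 * B * (dot x e - l)
  + - B * (dot x e - l) ^+ 2 + 0 * expR (0 * (dot x e - l))).
  have : 0 <= B * t x ^+ 2 by rewrite mulr_ge0 ?sqr_ge0 // /B; lra.
  rewrite /w /t; lra.
apply: H; last by rewrite -subr_ge0.
- by move=> s; rewrite -subr_ge0 => ?; exact: mulr_ge0.
- move=> y y1; rewrite -subr_ge0 -/(t y) => ty; rewrite (usphere y1).
  have := sphere_upper y1 ty.
  have ty1 : t y <= 1 by apply: t_le1; rewrite y1.
  have ty2 : 0 <= 1 - t y by rewrite subr_ge0.
  have := mulr_ge0 B_ge0 (mulr_ge0 ty ty2).
  lra.
- move=> y y1 y2; rewrite refl_plane //.
  by rewrite y2 subrr; lra.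
- move=> y /unit_ballE By; rewrite -subr_gt0 -/(t y) => ty _.
  have /andP[h1 h2] := laplacian_range By.
  have /andP[h3 h4] := laplacian_range (refl_ball e1 l0 (ltW ty) By).
  rewrite /B.
  by move: (laplacian u y) (laplacian u (refl e l y)) h1 h2 h3 h4 => p q; lra.
Qed.

Lemma reflection_lower x : dot x x <= 1 -> 0 <= t x -> - (9 * B * t x) <= w x.
Proof.
move=> x1 tx; have Lam0 := Lam_ge0.
have := @comparison _ _ u e u2 uc e1 l 1 (-1) 0 (9 * B) (- B) 0 0 l.
rewrite /excess /barrier.
move=> /(_ _ _ _ _ x x1) H.
have tx0 := tx.
suff : 0 <= 1 * u (refl e l x) + -1 * u x + (0 + 9 * B * (dot x e - l)
  + - B * (dot x e - l) ^+ 2 + 0 * expR (0 * (dot x e - l))).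
  have : 0 <= B * t x ^+ 2 by rewrite mulr_ge0 ?sqr_ge0 // /B; lra.
  rewrite /w /t; lra.
apply: H; last by rewrite -subr_ge0.
- by move=> s; rewrite -subr_ge0 => ?; exact: mulr_ge0.
- move=> y y1; rewrite -subr_ge0 -/(t y) => ty; rewrite (usphere y1).
  have ty1 : t y <= 1 by apply: t_le1; rewrite y1.
  have : 0 <= u (refl e l y) by apply: u_closed_ge0; apply: refl_closed => //; rewrite y1.
  have : 0 <= B * (t y * (9 - t y)) by rewrite !mulr_ge0 /B //; lra.
  lra.
- move=> y y1 y2; rewrite refl_plane //.
  by rewrite y2 subrr; lra.
- move=> y /unit_ballE By; rewrite -subr_gt0 -/(t y) => ty _.
  have /andP[h1 h2] := laplacian_range By.
  have /andP[h3 h4] := laplacian_range (refl_ball e1 l0 (ltW ty) By).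
  rewrite /B.
  by move: (laplacian u y) (laplacian u (refl e l y)) h1 h2 h3 h4 => p q; lra.
Qed.

(** Turns a constant lower bound into one vanishing on the plane. Where w_l is below minus the
    barrier [2 P t - P t^2], it is nonpositive, so |w_l| is at most [N] and its Laplacian is below
    [2 * P]. *)
Lemma cap_lower (N P : R) : 0 <= N -> Lam * N + 2 * L * eps < 2 * P ->
  (forall x, dot x x < 1 -> 0 < t x -> - N <= w x) ->
  forall x, dot x x <= 1 -> 0 <= t x -> - (2 * P * t x) <= w x.
Proof.
move=> N0 NP low x x1 tx; have Lam0 := Lam_ge0.
have Le0 : 0 <= 2 * L * eps by rewrite !mulr_ge0.
have LN0 : 0 <= Lam * N by rewrite mulr_ge0.
have P0 : 0 <= P by lra.
have := @comparison _ _ u e u2 uc e1 l 1 (-1) 0 (2 * P) (- P) 0 0 l.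
rewrite /excess /barrier.
move=> /(_ _ _ _ _ x x1) H.
suff : 0 <= 1 * u (refl e l x) + -1 * u x + (0 + 2 * P * (dot x e - l)
  + - P * (dot x e - l) ^+ 2 + 0 * expR (0 * (dot x e - l))).
  have : 0 <= P * t x ^+ 2 by rewrite mulr_ge0 ?sqr_ge0.
  rewrite /w /t; lra.
apply: H; last by rewrite -subr_ge0.
- by move=> s; rewrite -subr_ge0 => ?; exact: mulr_ge0.
- move=> y y1; rewrite -subr_ge0 -/(t y) => ty; rewrite (usphere y1).
  have ty2 : 0 <= 2 - t y by have := @t_le1 y; rewrite y1 => /(_ (lexx _)); lra.
  have : 0 <= u (refl e l y) by apply: u_closed_ge0; apply: refl_closed => //; rewrite y1.
  have := mulr_ge0 P0 (mulr_ge0 ty ty2).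
  lra.
- move=> y y1 y2; rewrite refl_plane // y2 subrr; lra.
- move=> y y1; rewrite -subr_gt0 -/(t y) => ty Fy.
  have By : unit_ball y by apply/unit_ballE.
  have ty1 : t y <= 1 by rewrite t_le1 // ltW.
  have wN : `|w y| <= N.
    have Pt : 0 <= P * (t y * (2 - t y)) by rewrite !mulr_ge0 // ?ltW // subr_gt0; lra.
    rewrite ler_norml low //=.
    have : w y <= 0 by rewrite /w; lra.
    by move/le_trans; apply.
  have h1 : Lam * `|w y| <= Lam * N by rewrite ler_wpM2l.
  have h2 : 2 * L * eps * t y <= 2 * L * eps by rewrite ler_piMr.
  have := laplacian_difference_ge e1 l0 By (ltW ty).
  rewrite -/(w y) -/(t y).
  move: (laplacian u y) (laplacian u (refl e l y)) (`|w y|) h1 h2 => p q r h1 h2; lra.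
Qed.

(** * The exponential barrier, on the cap and in a narrow strip *)

Variable A : R.
Hypothesis l_gt0 : 0 < l.
Hypothesis A_small : A * B * expR B <= 2 * l / C0.
Hypothesis A_large : 2 * L * eps < A.

Let Le_ge0 : 0 <= 2 * L * eps. Proof. by rewrite !mulr_ge0. Qed.

Lemma A_gt0 : 0 < A. Proof. exact: le_lt_trans A_large. Qed.

Lemma B_ge1 : 1 <= B. Proof. by rewrite /B lerDr Lam_ge0. Qed.

(** On [[0, 1]] the exponential barrier lies below [A * B * expR B * t], which [A_small] places
    below the bound of [sphere_lower]. *)
Lemma sphere_barrier x : dot x x = 1 -> 0 <= t x -> A * (expR (B * t x) - 1) <= w x.
Proof.
move=> x1 tx; rewrite /w (usphere x1) subr0.
have tI : 0 <= t x <= 1 by rewrite tx t_le1 // x1.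
apply: le_trans (sphere_lower x1 l_gt0 tx).
apply: (@le_trans _ _ (A * (B * expR B * t x))).
  by rewrite ler_pM2l ?A_gt0 // expR_sub1_le // B_ge0.
by rewrite !mulrA ler_wpM2r.
Qed.

Lemma expR_t_ge1 x : 0 <= t x -> 1 <= expR (B * t x).
Proof.
move=> tx; apply: le_trans (expR_ge1Dx (B * t x)).
by rewrite lerDl mulr_ge0 // B_ge0.
Qed.

(** Where w_l lies below the barrier, its nonnegativity bounds |w_l| by the barrier, and then the
    Laplacian of w_l is strictly below that of the barrier. *)
Lemma cap_improvement : (forall x, dot x x < 1 -> 0 < t x -> 0 <= w x) ->
  forall x, dot x x <= 1 -> 0 <= t x -> A * (expR (B * t x) - 1) <= w x.
Proof.
move=> wge0 x x1 tx.
have := @comparison _ _ u e u2 uc e1 l 1 (-1) A 0 0 (-A) B l.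
rewrite /excess /barrier.
move=> /(_ _ _ _ _ x x1) H.
suff : 0 <= 1 * u (refl e l x) + -1 * u x + (A + 0 * (dot x e - l)
  + 0 * (dot x e - l) ^+ 2 + - A * expR (B * (dot x e - l))).
  rewrite -/(t x) /w; lra.
apply: H; last by rewrite -subr_ge0.
- by move=> s; rewrite -subr_ge0 => ?; exact: mulr_ge0.
- move=> y y1; rewrite -subr_ge0 -/(t y) => ty; have := sphere_barrier y1 ty.
  rewrite /w; lra.
- move=> y y1 y2; rewrite refl_plane // y2 subrr [B * 0]mulr0 expR0; lra.
- move=> y y1; rewrite -subr_gt0 -/(t y) => ty Fy.
  have By : unit_ball y by apply/unit_ballE.
  have wy := wge0 y y1 ty.
  have h2 : w y <= A * (expR (B * t y) - 1) + 0.
    move: Fy; rewrite /w; lra.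
  have tI : 0 <= t y <= 1 by rewrite ltW //= t_le1 // ltW.
  have := subsolution_inequality Lam_ge0 (lexx 0) Le_ge0 A_large (expR_t_ge1 (ltW ty)) tI h2.
  have := laplacian_difference_ge e1 l0 By (ltW ty).
  rewrite -/(w y) -/(t y) (ger0_norm wy) -/B.
  move: (laplacian u y) (laplacian u (refl e l y)) (t y) (w y) (expR (B * t y)) => p q *; lra.
Qed.

(* Maximum principle for a zeroth-order term of either sign: minimize [(w - q) / phi] with
   [phi = 1 - B t^2], a positive strict supersolution when the strip is thin. *)
Lemma narrow_strip (d : R) : B * d ^+ 2 <= 2^-1 ->
  (forall x, dot x x < 1 -> d <= t x -> A * (expR (B * t x) - 1) <= w x) ->
  forall x, dot x x <= 1 -> 0 <= t x -> A * (expR (B * t x) - 1) <= w x.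
Proof.
move=> d_small far x x1 tx; rewrite leNgt; apply/negP => wx.
pose G := excess u e l 1 (-1) A 0 0 (-A) B.
have GE y : G y = w y - A * (expR (B * t y) - 1).
  by rewrite /G /excess /barrier -/(t y) /w; ring.
pose phi y := 1 - B * t y ^+ 2.
pose D := [set y : 'rV[R]_n | dot y y <= 1] `&` [set y | l <= dot y e]
  `&` [set y | dot y e <= l + d].
have cD : closed D.
  apply: closedI; last exact: closed_dot_le.
  by apply: closedI; [exact: closed_cball|exact: closed_dot_ge].
have good y : dot y y <= 1 -> 0 <= t y -> d <= t y -> 0 <= G y.
  rewrite le_eqVlt => /orP[/eqP y1|y1] ty dy; rewrite GE subr_ge0.
    exact: sphere_barrier.
  exact: far.
have Dx : D x.
  split; first by split => //=; rewrite -subr_ge0.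
  rewrite /= leNgt -ltrBrDl -/(t x); apply/negP => h.
  have := good x x1 tx (ltW h); rewrite GE subr_ge0 leNgt wx //.
have phi_half y : D y -> 2^-1 <= phi y.
  move=> [[_ /= h1] h2]; rewrite /phi.
  have ty : 0 <= t y by rewrite subr_ge0.
  have tyd : t y <= d by rewrite lerBlDl.
  have : B * t y ^+ 2 <= B * d ^+ 2.
    by rewrite ler_wpM2l ?B_ge0 // lerXn2r // nnegrE // (le_trans ty).
  lra.
(* The maximum with 1/2 keeps the denominator positive everywhere, hence [v] continuous; on the
   strip it is inactive and [v] is [G / phi]. *)
pose v y := (1 * (u \o clamp) (refl e l y) + -1 * (u \o clamp) y
    + barrier A 0 0 (-A) B (dot y e - l)) /
  Num.max (barrier 1 0 (- B) 0 0 (dot y e - l)) 2^-1.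
have cv : continuous v.
  move=> y; have Fy : Filter (nbhs y) := nbhs_filter y.
  apply: cvgM; first exact: ext_excess_continuous.
  apply: cvgV; first by rewrite gt_eqF // lt_max invr_gt0 ltr0n orbT.
  apply: (@continuous_max _ _ (fun y => barrier 1 0 (- B) 0 0 (dot y e - l)) (fun=> 2^-1));
    last exact: cst_continuous.
  apply: (@continuous_comp _ _ _ (fun x => dot x e - l) (barrier 1 0 (- B) 0 0)).
    by apply: cvgB; [exact: dot_dir_continuous|exact: cvg_cst].
  exact: barrier_continuous.
have vE y : D y -> v y = G y / phi y.
  move=> Dy; have ty : 0 <= t y by rewrite subr_ge0; case: Dy => [[]].
  rewrite /v ext_excessE //; [|by case: Dy => [[]]|exact: mulr_ge0].
  congr (_ / _); have -> : barrier 1 0 (- B) 0 0 (dot y e - l) = phi y.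
    by rewrite /barrier /phi -/(t y); ring.
  by rewrite max_l // phi_half.
have [c Dc cmin] := ball_minimum cD (fun y (Dy : D y) => Dy.1.1) (ex_intro _ x Dx) cv.
have phi_gt0 y : D y -> 0 < phi y.
  by move=> /phi_half; apply: lt_le_trans; rewrite invr_gt0.
pose m := - v c.
have m0 : 0 < m.
  rewrite oppr_gt0; apply: le_lt_trans (cmin x Dx) _.
  by rewrite vE // pmulr_llt0 ?invr_gt0 ?phi_gt0 // GE subr_lt0.
have Gc : G c = - m * phi c.
  by rewrite /m opprK vE // divfK // gt_eqF // phi_gt0.
have Gc0 : G c < 0 by rewrite Gc pmulr_llt0 ?phi_gt0 // oppr_lt0.
have GD y : D y -> - m * phi y <= G y.
  move=> Dy; rewrite /m opprK -ler_pdivlMr ?phi_gt0 // -vE //; exact: cmin.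
have [[c1 /= lc] cd] := Dc.
have tc : 0 <= t c by rewrite subr_ge0.
have c1' : dot c c < 1.
  rewrite lt_neqAle c1 andbT; apply/eqP => cc.
  by move: Gc0; rewrite GE subr_lt0 ltNge sphere_barrier.
have lc' : l < dot c e.
  rewrite lt_neqAle lc andbT; apply/eqP => cc.
  move: Gc0; rewrite GE /w refl_plane // /t -cc !subrr mulr0 expR0 subrr mulr0 subrr ltxx //.
have cd' : dot c e < l + d.
  rewrite ltNge; apply/negP => h; have dc : d <= t c by rewrite lerBrDl.
  by have := good c c1 tc dc; rewrite leNgt Gc0.
(* [G + m * phi] is again an excess, and it has the minimum 0 over the strip at [c], so the interior
   minimum lemma applies to it. *)
have FE y : excess u e l 1 (-1) (A + m) 0 (- (m * B)) (- A) B y = G y + m * phi y.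
  by rewrite /G /excess /barrier /phi -/(t y); ring.
have cnear : \forall y \near c, excess u e l 1 (-1) (A + m) 0 (- (m * B)) (- A) B c
    <= excess u e l 1 (-1) (A + m) 0 (- (m * B)) (- A) B y.
  have H2 : \forall y \near c, dot y e < l + d.
    by move/cvgr_lt : (@dot_dir_continuous R n e c); exact.
  apply: filterS2 (near_inside c1' lc') H2 => y [y1 y2] y3.
  rewrite !FE Gc mulNr addNr.
  have Dy : D y by split; [split|]; exact: ltW.
  by have := GD y Dy; rewrite mulNr -subr_ge0 opprK.
have := @excess_minimum _ _ u e u2 e1 l _ _ _ _ _ _ _ c c1' (mulr_ge0 l0 tc) cnear.
have By : unit_ball c by apply/unit_ballE.
have E1 := expR_t_ge1 tc.
have wc : w c = A * (expR (B * t c) - 1) - m * phi c.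
  by have := GE c; rewrite Gc => h; rewrite -[LHS](subrK (A * (expR (B * t c) - 1))) -h; ring.
have phi1 : phi c <= 1.
  by rewrite /phi gerBl mulr_ge0 ?B_ge0 ?sqr_ge0.
have h2 : `|w c| <= A * (expR (B * t c) - 1) + m.
  have q0 : 0 <= A * (expR (B * t c) - 1) by rewrite mulr_ge0 ?subr_ge0 // ltW // A_gt0.
  have mphi : m * phi c <= m by rewrite ler_piMr // ltW.
  have mphi0 : 0 <= m * phi c by rewrite mulr_ge0 // ltW // phi_gt0.
  rewrite ler_norml wc; apply/andP; split; lra.
have tI : 0 <= t c <= 1 by rewrite tc t_le1.
have := subsolution_inequality Lam_ge0 (ltW m0) Le_ge0 A_large E1 tI h2.
have := laplacian_difference_ge e1 l0 By tc.
rewrite -/(w c) -/(t c) -/B.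
move: (laplacian u c) (laplacian u (refl e l c)) (t c) (`|w c|) (expR (B * t c)) => p q *; lra.
Qed.

End Plane.

(** After ordering by norm, the two points are exchanged by a reflection with [l >= 0] and
    [t = |x - z| / 2], so the linear bounds on w_l are Lipschitz bounds. *)
Lemma u_lipschitz x z : unit_ball x -> unit_ball z ->
  `|u x - u z| <= 9 * B / 2 * enorm (x - z).
Proof.
wlog zx : x z / dot z z <= dot x x.
  move=> H Bx Bz; have [zx|/ltW xz] := leP (dot z z) (dot x x); first exact: H.
  by rewrite distrC -[x - z]opprB enormN; exact: H.
move=> Bx Bz; have [->|xz] := eqVneq x z.
  by rewrite subrr normr0 mulr_ge0 ?enorm_ge0 // mulr_ge0 // mulr_ge0 // B_ge0.
have [e [l [e1 Rx tx lE]]] := reflection_pair xz.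
have l0 : 0 <= l by rewrite lE divr_ge0 ?subr_ge0 // mulr_ge0 // enorm_ge0.
have x1 : dot x x <= 1 by apply/ltW/unit_ballE.
have tx0 : 0 <= dot x e - l by rewrite tx divr_ge0 // enorm_ge0.
have := reflection_upper e1 l0 x1 tx0; have := reflection_lower e1 l0 x1 tx0.
rewrite Rx tx distrC ler_norml => h1 h2; apply/andP; split; lra.
Qed.

(** With [A = rho / slack], the sphere condition on the amplitude holds even for [2 * A] at every
    [l >= rho], and [2 * L * eps * slack < rho] says [2 * L * eps < A]. *)
Definition slack := C0 * B * expR B.

Lemma slack_ge1 : 1 <= slack.
Proof.
rewrite /slack; apply: mulr_ege1; last first.
  by apply: le_trans (expR_ge1Dx B); rewrite lerDl B_ge0.
by apply: mulr_ege1 => //; exact: B_ge1.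
Qed.

Lemma slack_gt0 : 0 < slack. Proof. exact: lt_le_trans ltr01 slack_ge1. Qed.

(** * Moving the plane from the boundary down to [rho] *)

Section Moving.
Variables (e : 'rV[R]_n) (rho : R).
Hypothesis e1 : dot e e = 1.
Hypothesis rho_gt0 : 0 < rho.
Hypothesis rho_lt1 : rho < 1.
Hypothesis rho_large : 2 * L * eps * slack < rho.

Let A := rho / slack.

Lemma A_pos : 0 < A. Proof. by rewrite divr_gt0 // slack_gt0. Qed.

Lemma A_le1 : A <= 1.
Proof. by rewrite ler_pdivrMr ?slack_gt0 // mul1r (le_trans (ltW rho_lt1)) // slack_ge1. Qed.

Lemma A_large_rho : 2 * L * eps < A.
Proof. by rewrite ltr_pdivlMr // slack_gt0. Qed.

Lemma A_slack : A * B * expR B = rho / C0.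
Proof.
have Cn : C0 != 0 by rewrite gt_eqF // (lt_le_trans ltr01).
have Bn : B != 0 by rewrite gt_eqF // (lt_le_trans ltr01) // B_ge1.
have En : expR B != 0 by rewrite gt_eqF // expR_gt0.
by rewrite /A /slack; move: (expR B) En => E En; field; rewrite Cn Bn En.
Qed.

Lemma A2_small l : rho <= l -> 2 * A * B * expR B <= 2 * l / C0.
Proof.
move=> rl; rewrite (_ : 2 * A * B * expR B = 2 * (A * B * expR B)); last by ring.
rewrite A_slack -mulrA ler_pM2l // ler_pM2r // invr_gt0 (lt_le_trans ltr01) //.
Qed.

Lemma A1_small l : rho <= l -> A * B * expR B <= 2 * l / C0.
Proof.
move=> rl; apply: le_trans (A2_small rl).
rewrite ler_pM2r ?expR_gt0 // ler_pM2r ?(lt_le_trans ltr01 B_ge1) //.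
by have := A_pos; lra.
Qed.

(** The factor 2 is the reserve spent by [plane_step] when the plane is moved. *)
Lemma doubled l : rho <= l ->
  (forall x, dot x x < 1 -> 0 < dot x e - l -> 0 <= u (refl e l x) - u x) ->
  forall x, dot x x <= 1 -> 0 <= dot x e - l ->
  2 * A * (expR (B * (dot x e - l)) - 1) <= u (refl e l x) - u x.
Proof.
move=> rl; have l0 : 0 < l by exact: lt_le_trans rl.
apply: cap_improvement (ltW l0) _ l0 (A2_small rl) _ => //.
by have := A_large_rho; have := A_pos; lra.
Qed.

(** The shift changes the reflected value of [u] by at most [9 * B * tau <= A / 4] and lowers the
    exponential at most by the factor [1 - A / 36]. At distance [1 / (2 B)] or more from the plane
    the exponential is at least 3/2, and halving the amplitude [2 * A] pays for both losses. *)
Lemma plane_step l l' x : rho <= l -> l <= l' -> l' - l <= A / (36 * B) ->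
  dot x x < 1 -> (2 * B)^-1 <= dot x e - l ->
  2 * A * (expR (B * (dot x e - l')) - 1) <= u (refl e l' x) - u x ->
  A * (expR (B * (dot x e - l)) - 1) <= u (refl e l x) - u x.
Proof.
move=> rl ll' dl x1 tx; set tau := l' - l in dl.
have tau0 : 0 <= tau by rewrite subr_ge0.
have B1 := B_ge1; have B0 : 0 < B by lra.
have A0 := A_pos; have A1 := A_le1.
have l0 : 0 <= l by apply: le_trans rl; exact: ltW.
have Btau : B * tau <= A / 36.
  by rewrite mulrC -ler_pdivlMr // -mulrA -invfM.
have half : 2^-1 <= B * (dot x e - l).
  have := ler_wpM2l (ltW B0) tx.
  by rewrite invfM mulrCA mulfV ?mulr1 ?gt_eqF.
have tx' : 0 <= dot x e - l'.
  have : 0 <= B * (dot x e - l') by rewrite /tau in Btau; lra.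
  by rewrite pmulr_rge0.
have tx0 : 0 <= dot x e - l by lra.
have Bx : unit_ball x by apply/unit_ballE.
have l0' : 0 <= l' by exact: le_trans ll'.
have lip := u_lipschitz (refl_ball e1 l0' tx' Bx) (refl_ball e1 l0 tx0 Bx).
have dE : enorm (refl e l' x - refl e l x) = 2 * tau.
  rewrite !reflE opprD addrACA subrr add0r -scalerBl enormZ enormE e1 sqrtr1 mulr1.
  by rewrite (_ : _ - _ = 2 * tau) ?ger0_norm ?mulr_ge0 // /tau; ring.
rewrite dE in lip; have := le_trans (ler_norm _) lip.
set E := expR (B * (dot x e - l)).
have E0 : 0 < E by exact: expR_gt0.
have E32 : 3 / 2 <= E.
  by have := expR_ge1Dx (B * (dot x e - l)); rewrite -/E; lra.
have E' : E * (1 - B * tau) <= expR (B * (dot x e - l')).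
  rewrite (_ : B * (dot x e - l') = B * (dot x e - l) + - (B * tau)); last first.
    by rewrite /tau; ring.
  by rewrite expRD -/E ler_pM2l // expR_ge1Dx.
move: (u (refl e l' x)) (u (refl e l x)) (u x) (expR (B * (dot x e - l'))) E'.
move=> a b c F E' h1 h2.
have h3 : A * (E * (1 - B * tau)) <= A * F by rewrite ler_pM2l.
have h4 : E * (B * tau) <= E * (A / 36) by rewrite ler_pM2l.
have h5 : A * (E * (B * tau)) <= A * (E * 36^-1).
  by rewrite ler_pM2l // ler_pM2l //; lra.
have h6 : A * (3 / 2) <= A * E by rewrite ler_pM2l.
lra.
Qed.

Lemma moving_planes l x : rho <= l -> l < 1 -> dot x x <= 1 -> 0 <= dot x e - l ->
  2 * A * (expR (B * (dot x e - l)) - 1) <= u (refl e l x) - u x.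
Proof.
have B1 := B_ge1; have B0 : 0 < B by lra.
have A0 := A_pos; have A1 := A_le1.
pose tau := A / (36 * B).
have tau0 : 0 < tau by rewrite divr_gt0 // mulr_gt0.
pose d := (2 * B)^-1.
have d0 : 0 < d by rewrite invr_gt0 mulr_gt0.
have taud : tau < d.
  rewrite /tau /d invfM mulrA invfM ltr_pM2r ?invr_gt0 //; lra.
have dB : B * d ^+ 2 <= 2^-1.
  rewrite /d (_ : B * _ = (4 * B)^-1); last by field; rewrite gt_eqF.
  by rewrite lef_pV2 ?posrE ?mulr_gt0 //; lra.
(* Induction on the number [k] of steps of length [tau] below [1 - d]. Amplitude [A] is enough here:
   it implies nonnegativity, from which [doubled] recovers [2 * A]. *)
suff H (k : nat) : forall l, rho <= l -> l < 1 -> 1 - d - k%:R * tau <= l ->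
    forall x, dot x x <= 1 -> 0 <= dot x e - l ->
    A * (expR (B * (dot x e - l)) - 1) <= u (refl e l x) - u x.
  move=> rl l1; apply: doubled => // y y1 ty.
  have [k Hk] : exists k : nat, tau^-1 < k%:R.
    by exists (Num.bound tau^-1); apply: archi_boundP; rewrite invr_ge0 ltW.
  apply: le_trans (H k l rl l1 _ y (ltW y1) (ltW ty)).
    rewrite mulr_ge0 ?subr_ge0 ?(ltW A0) //.
    by rewrite -expR0 ler_expR mulr_ge0 // ltW.
  have : 1 < k%:R * tau by rewrite -ltr_pdivrMr // mul1r.
  have : 0 < l by exact: lt_le_trans rl.
  lra.
have start l0 : rho <= l0 -> (forall y, dot y y < 1 -> d <= dot y e - l0 ->
      A * (expR (B * (dot y e - l0)) - 1) <= u (refl e l0 y) - u y) ->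
    forall x, dot x x <= 1 -> 0 <= dot x e - l0 ->
    A * (expR (B * (dot x e - l0)) - 1) <= u (refl e l0 x) - u x.
  move=> rl; have l00 : 0 < l0 by exact: lt_le_trans rl.
  by apply: narrow_strip (ltW l00) _ l00 (A1_small rl) A_large_rho _ dB.
(* For [l0 >= 1 - d] the cap is thinner than [d], so nothing has to be checked away from the
   plane. *)
have base l0 : rho <= l0 -> 1 - d <= l0 -> forall x, dot x x <= 1 -> 0 <= dot x e - l0 ->
    A * (expR (B * (dot x e - l0)) - 1) <= u (refl e l0 x) - u x.
  move=> rl dl; apply: start => // y y1 ty; exfalso.
  have y2 : dot y e ^+ 2 < 1 by exact: le_lt_trans (sqr_dot_le y e1) y1.
  have : dot y e < 1.
    by rewrite -(expr_lt1 (n := 2)) //; have : 0 < l0 := lt_le_trans rho_gt0 rl; lra.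
  lra.
elim: k => [|k IH] {}l rl l1 kl {}x; first by apply: base => //; move: kl; rewrite mul0r subr0.
have [dl|dl] := leP (1 - d) l; first exact: base.
apply: start => // y y1 ty.
(* The previous position of the plane. Since [l < 1 - d] and [tau < d], it is still below 1, and
   points at distance at least [d] from the new plane lie beyond it. *)
pose l' := l + tau.
have rl' : rho <= l' by rewrite /l'; lra.
have l1' : l' < 1 by rewrite /l'; lra.
have kl' : 1 - d - k%:R * tau <= l'.
  by move: kl; rewrite /l' -natr1 mulrDl mul1r; lra.
have IH' := IH l' rl' l1' kl'.
have ty' : 0 <= dot y e - l' by rewrite /l'; lra.
apply: (@plane_step l l') => //.
- by rewrite /l' lerDl ltW.
- by rewrite /l' addrC addKr.
apply: (doubled rl') => //; last exact: ltW.
move=> z z1 tz; apply: le_trans (IH' z (ltW z1) (ltW tz)).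
rewrite mulr_ge0 ?subr_ge0 ?(ltW A0) //.
by rewrite -expR0 ler_expR mulr_ge0 // ltW.
Qed.

End Moving.

(** * Almost radial monotonicity and symmetry of [u] *)

Definition shift_constant := 18 * B + C0.

Lemma shift_constant_gt0 : 0 < shift_constant.
Proof. by rewrite /shift_constant; have := B_ge0; have := C01; lra. Qed.

(** The point [z] is pulled towards the origin to a point [z'] of norm at most [|x| - 2 rho]. The
    plane bisecting [x] and [z'] has [l >= rho], so [u x <= u z'], and [z'] is within [2 * rho] of
    [z]. *)
Lemma almost_decreasing x z (rho : R) : unit_ball x -> unit_ball z ->
  dot z z <= dot x x -> 0 < rho -> 2 * L * eps * slack < rho ->
  u x - u z <= shift_constant * rho.
Proof.
move=> Bx Bz zx rho0 rhoL; have B0 := B_ge0.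
have C00 : 0 < C0 by exact: lt_le_trans C01.
have uz := upos Bz; have ux := uup Bx.
have BR : 0 <= B * rho by rewrite mulr_ge0 // ltW.
have CR : 0 <= C0 * rho by rewrite mulr_ge0 // ltW.
rewrite /shift_constant mulrDl.
(* For [rho >= 1] the bound [u x <= C0] suffices, whence the term [C0] of [shift_constant]. *)
have [rho1|rho1] := leP 1 rho.
  have : C0 <= C0 * rho by rewrite ler_peMr // ltW.
  lra.
have ezx : enorm z <= enorm x by rewrite !enormE ler_wsqrtr.
(* Near the origin both points lie within [4 * rho] of each other, and the Lipschitz bound yields
   the term [18 * B]. *)
have [xr|xr] := ltP (enorm x) (2 * rho).
  have := u_lipschitz Bx Bz; have := ler_norm (u x - u z).
  have : 9 * B / 2 * enorm (x - z) <= 9 * B / 2 * (4 * rho).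
    apply: ler_wpM2l; first by rewrite divr_ge0 // mulr_ge0.
    by have := enormB_le x z; lra.
  lra.
have ex0 : 0 < enorm x by lra.
pose s := 1 - 2 * rho / enorm x.
have s0 : 0 <= s by rewrite subr_ge0 ler_pdivrMr // mul1r.
have s1 : 1 - s = 2 * rho / enorm x by rewrite /s; ring.
have s10 : 0 <= 1 - s by rewrite s1 divr_ge0 ?mulr_ge0 // ltW.
pose z' := s *: z.
have ez' : enorm z' <= enorm x - 2 * rho.
  rewrite enormZ ger0_norm // (_ : enorm x - 2 * rho = s * enorm x); last first.
    by rewrite /s; field; rewrite gt_eqF.
  exact: ler_wpM2l.
have Bz' : unit_ball z'.
  by move: Bx; rewrite /unit_ball /= => Bx; lra.
have dzz : enorm (z - z') <= 2 * rho.
  rewrite /z' -[X in X - _]scale1r -scalerBl enormZ ger0_norm // s1.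
  by rewrite mulrAC ler_pdivrMr // ler_wpM2l // mulr_ge0 // ltW.
have xz' : x != z'.
  by apply: contraTneq ez' => <-; rewrite -ltNge; lra.
have [e [l [e1 Rx tx lE]]] := reflection_pair xz'.
have exz0 : 0 < enorm (x - z') by apply: enorm_gt0; rewrite subr_eq0.
(* As [|x - z'| <= |x| + |z'|], the formula for [l] gives [l >= (|x| - |z'|) / 2]. *)
have rl : rho <= l.
  rewrite lE ler_pdivlMr ?mulr_gt0 // -!sqr_enorm.
  have := enormB_le x z'; have := enorm_ge0 z'; move: ez' rho0.
  move: (enorm x) (enorm z') (enorm (x - z')) => a b c h1 h2 h3 h4.
  have h5 : rho * c <= rho * (a + b) by rewrite ler_pM2l.
  have h6 : 0 <= (a + b) * (a - b - 2 * rho) by rewrite mulr_ge0; lra.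
  lra.
have x1 : dot x x < 1 by exact/unit_ballE.
have tx0 : 0 <= dot x e - l by rewrite tx divr_ge0 // enorm_ge0.
have l1 : l < 1 by have := dot_dir_le1 e1 (ltW x1); rewrite tx in tx0 *; move=> /andP[_]; lra.
have mp := moving_planes e1 rho0 rho1 rhoL rl l1 (ltW x1) tx0.
have q0 : 0 <= 2 * (rho / slack) * (expR (B * (dot x e - l)) - 1).
  rewrite mulr_ge0 ?subr_ge0 //; last by rewrite -expR0 ler_expR mulr_ge0.
  by rewrite mulr_ge0 // divr_ge0 // ltW // (lt_le_trans _ slack_ge1).
have h1 : u x <= u z' by rewrite -subr_ge0 -Rx; exact: le_trans q0 mp.
have := u_lipschitz Bz' Bz; have := ler_norm (u z' - u z).
have : 9 * B / 2 * enorm (z' - z) <= 9 * B / 2 * (2 * rho).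
  apply: ler_wpM2l; first by rewrite divr_ge0 // mulr_ge0.
  by rewrite -enormN opprB.
lra.
Qed.

Definition symmetry_constant := shift_constant * (2 * L * slack).

Lemma symmetry_constant_ge0 : 0 <= symmetry_constant.
Proof.
by rewrite mulr_ge0 ?(ltW shift_constant_gt0) // mulr_ge0 ?(ltW slack_gt0) // mulr_ge0.
Qed.

(** The limit of [almost_decreasing] as [rho] decreases to [2 * L * eps * slack]. *)
Lemma almost_radial x z : unit_ball x -> unit_ball z -> dot z z <= dot x x ->
  u x - u z <= symmetry_constant * eps.
Proof.
move=> Bx Bz zx; have S0 := shift_constant_gt0.
apply/ler_addgt0Pr => th th0.
have q0 : 0 <= 2 * L * eps * slack.
  by apply: mulr_ge0; [rewrite !mulr_ge0|exact: ltW slack_gt0].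
have t0 : 0 < th / shift_constant by rewrite divr_gt0.
have := @almost_decreasing x z (2 * L * eps * slack + th / shift_constant) Bx Bz zx.
rewrite ltr_wpDl // ltrDl t0 => /(_ isT isT) /le_trans; apply.
rewrite /symmetry_constant mulrDr [shift_constant * (th / _)]mulrCA mulfV ?gt_eqF //; lra.
Qed.

(** * The bound on the radial derivative *)

Definition radial_constant := (Lam * symmetry_constant + 2 * L) / 2.

Lemma radial_constant_ge0 : 0 <= radial_constant.
Proof.
apply: divr_ge0 => //; apply: addr_ge0; apply: mulr_ge0 => //.
  exact: Lam_ge0.
exact: symmetry_constant_ge0.
Qed.

(** The plane through [x] orthogonal to [x / |x|] exchanges [x + s e] and [x - s e], so linear lower
    bounds on w_l bound centered differences. For [eps > 0] the summand 1 makes the inequality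
    strict. *)
Lemma radial_derivative_lt x : unit_ball x -> x != 0 ->
  radial_derivative u x < (radial_constant + 1) * eps.
Proof.
move=> Bx x0.
have ex := enorm_gt0 x0; pose e := (enorm x)^-1 *: x.
have e1 : dot e e = 1 := unit_normalize x0.
have xe : dot x e = enorm x by rewrite dotZr -sqr_enorm; field; rewrite gt_eqF.
have x1 : enorm x < 1 := Bx.
have u1 : Ck 1 unit_ball u.
  by case: u2 => cu du; split=> // i; case: (du i) => H [? _]; split.
have -> : radial_derivative u x = \sum_i e 0 i * partial i u x.
  by apply: eq_bigr => i _; rewrite !mxE mulrC [RHS]mulrC [x 0 i / _]mulrC.
clearbody e.
have r0 : 0 < 1 - enorm x by lra.
have inside s : 0 < s < 1 - enorm x ->
    [/\ dot (x + s *: e) (x + s *: e) <= 1, dot (x + s *: e) e - dot x e = s &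
      refl e (dot x e) (x + s *: e) = x - s *: e].
  move=> /andP[s0 s1]; split; last exact: refl_line_dir.
    rewrite dotDl !dotDr !dotZl !dotZr e1 (dotC e x) xe -sqr_enorm.
    have : 0 <= (1 - (enorm x + s)) * (1 + (enorm x + s)) by rewrite mulr_ge0 //; lra.
    lra.
  by rewrite dotDl dotZl e1; ring.
have l0 : 0 <= dot x e by rewrite xe ltW.
(* If [eps = 0] the right side is 0, so strict negativity is needed: [moving_planes] with
   [rho = l = |x|] bounds the derivative by [- |x| / slack]. *)
have [e0|epos] := eqVneq eps 0.
  have rl : 2 * L * eps * slack < dot x e by rewrite e0 mulr0 mul0r xe.
  have l1 : dot x e < 1 by rewrite xe.
  have lp : 0 < dot x e by rewrite xe.
  have S0 := slack_gt0.
  have a0 : 0 < dot x e / slack by rewrite divr_gt0.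
  rewrite e0 mulr0; apply: (@le_lt_trans _ _ (- (dot x e / slack))); last by rewrite oppr_lt0.
  apply: (centered_derivative_le u1 Bx r0) => s sI.
  have [y1 ty Ry] := inside s sI; have /andP[s0 _] := sI.
  have ty0 : 0 <= dot (x + s *: e) e - dot x e by rewrite ty ltW.
  have := moving_planes e1 lp l1 rl (lexx _) l1 y1 ty0.
  rewrite Ry ty.
  have B1 := B_ge1.
  have h1 : s <= expR (B * s) - 1.
    have := expR_ge1Dx (B * s); have : s <= B * s by rewrite ler_peMl // ltW.
    lra.
  have h2 : dot x e / slack * s <= dot x e / slack * (expR (B * s) - 1) by rewrite ler_pM2l.
  lra.
have eps_gt0 : 0 < eps by rewrite lt_def epos.
apply: (@le_lt_trans _ _ (radial_constant * eps)); last by rewrite ltr_pM2r //; lra.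
apply/ler_addgt0Pr => th th0.
apply: (centered_derivative_le u1 Bx r0) => s sI.
have [y1 ty Ry] := inside s sI; have /andP[s0 _] := sI.
(* [radial_constant * eps] is half of [Lam * N + 2 * L * eps] for [N = symmetry_constant * eps]; the
   arbitrary [th > 0] supplies the strict inequality required of [P]. *)
have := @cap_lower e (dot x e) e1 l0 (symmetry_constant * eps)
  (radial_constant * eps + th) _ _ _ (x + s *: e) y1.
rewrite ty Ry => H.
suff : - (2 * (radial_constant * eps + th) * s) <= u (x - s *: e) - u (x + s *: e) by lra.
apply: H; last exact: ltW.
- by rewrite mulr_ge0 // symmetry_constant_ge0.
- by rewrite /radial_constant; lra.
- move=> y yy tyy; have By : unit_ball y by apply/unit_ballE.
  rewrite lerNl opprB; apply: almost_radial => //.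
    exact: refl_ball (ltW tyy) By.
  by apply: refl_inside => //; rewrite mulr_ge0 // ltW.
Qed.

End MovingPlanes.

(** * From essential suprema and norms to pointwise bounds *)

Section EssentialSup.
Context {R : realType} {n : nat}.
Implicit Types g : 'rV[R]_n -> R.

(** Degenerate boxes have volume 0 because [n > 0]; an empty product would be 1. *)
Lemma lebesgue_null_set0 : (0 < n)%N -> lebesgue_null (set0 : set 'rV[R]_n).
Proof.
move=> n0 e e0; exists (fun=> 0), (fun=> 0); split=> // N.
rewrite big1 ?ltW // => k _; rewrite (bigD1 (Ordinal n0)) //= mxE subrr mul0r //.
Qed.

Lemma Linfty_norm_ge0 (Omega : set 'rV[R]_n) g : 0 <= Linfty_norm Omega g.
Proof.
rewrite /Linfty_norm; set S := [set M | _].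
have [[M SM]|S0] := pselect (S !=set0).
  by apply: lb_le_inf; [exists M|move=> m []].
(* The infimum of the empty set is 0 by convention. *)
rewrite (_ : S = set0) ?inf0 //; apply/seteqP; split=> // M SM; apply: S0; by exists M.
Qed.

(** By continuity, |g| exceeds any [m < |g x|] on a box around [x], and a box is not null. The bound
    [M] makes the set of essential bounds nonempty, so its infimum is not the default value. *)
Lemma le_Linfty_norm (Omega : set 'rV[R]_n) g (M : R) x : (0 < n)%N -> open Omega ->
  (forall y, Omega y -> {for y, continuous g}) ->
  (forall y, Omega y -> `|g y| <= M) -> Omega x -> `|g x| <= Linfty_norm Omega g.
Proof.
move=> n0 oO cg gM Ox; rewrite leNgt; apply/negP => inf_lt.
have M0 : 0 <= M by apply: le_trans (gM x Ox).
have S0 : [set M : R | 0 <= M /\ lebesgue_null [set x | Omega x /\ M < `|g x|]] !=set0.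
  exists M; split => //; rewrite (_ : [set _ | _] = set0); first exact: lebesgue_null_set0.
  by apply/seteqP; split => // y [Oy]; rewrite ltNge gM.
have hS : has_inf [set M : R | 0 <= M /\ lebesgue_null [set x | Omega x /\ M < `|g x|]].
  by split => //; exists 0 => m [].
have d0 : 0 < `|g x| - Linfty_norm Omega g by rewrite subr_gt0.
have [m [m0 null]] := inf_adherent d0 hS.
rewrite addrCA subrr addr0 => mg.
have : \forall y \near x, Omega y /\ m < `|g y|.
  have H1 : \forall y \near x, Omega y by apply: open_nbhs_nbhs; split.
  have H2 : \forall y \near x, m < `|g y|.
    have : (fun y => `|g y|) @ x --> `|g x|.
      have Fx : Filter (nbhs x) := nbhs_filter x.
      by apply: cvg_norm; exact: cg.
    by move/cvgr_gt; exact.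
  by apply: filterS2 H1 H2.
case/nbhs_ballP => r /= r0 Hr.
apply: (@lebesgue_nullN_cube R n _ (x - const_mx (r / 2)) (x + const_mx (r / 2))) null.
  by move=> i; rewrite !mxE; lra.
move=> y Hy; apply: Hr; rewrite -ball_normE /ball_ /=.
apply: (@le_lt_trans _ _ (r / 2)); last by lra.
rewrite /Num.norm /= mx_normrE; apply: bigmax_le; first by rewrite divr_ge0 // ltW.
move=> [j i] _ /=; rewrite (ord1 j) !mxE; have := Hy i; rewrite !mxE => /andP[h1 h2].
by rewrite ler_norml; apply/andP; split; lra.
Qed.

Lemma bounded_on_closure g : {within closure unit_ball, continuous g} ->
  exists2 M, 0 <= M & forall x, unit_ball x -> `|g x| <= M.
Proof.
move=> cg; have cv := clamp_comp_continuous cg.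
have cN : continuous (fun x => - `|(g \o clamp) x|).
  move=> x; have Fx : Filter (nbhs x) := nbhs_filter x.
  by apply: cvgN; apply: cvg_norm; exact: cv.
have ne : [set x : 'rV[R]_n | dot x x <= 1] !=set0.
  by exists 0; rewrite /= /dot big1 // => i _; rewrite mxE mul0r.
have [c _ cmin] := ball_minimum (@closed_cball R n) (fun x Hx => Hx) ne cN.
exists `|(g \o clamp) c| => // x /unit_ballE x1.
have := cmin x (ltW x1); rewrite lerN2 /= (clamp_id (ltW x1)) //.
Qed.

Lemma enorm_grad_bounded g : C1_closure unit_ball g ->
  exists M, forall x, unit_ball x -> enorm (grad g x) <= M.
Proof.
case=> _ _ ext.
have H i : exists M, forall x, unit_ball x -> `|partial i g x| <= M.
  have [h [ch hE]] := ext i; have [M _ HM] := bounded_on_closure ch.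
  by exists M => x Bx; rewrite -hE // HM.
have [M HM] := choice H.
exists (Num.sqrt (\sum_i M i ^+ 2)) => x Bx; rewrite /enorm ler_wsqrtr //.
apply: ler_sum => i _; rewrite mxE -(real_normK (num_real _)).
by rewrite lerXn2r // ?nnegrE ?(le_trans _ (HM i x Bx)) // HM.
Qed.

Lemma enorm_grad_continuous g x : Ck 1 unit_ball g -> unit_ball x ->
  {for x, continuous (fun z => enorm (grad g z))}.
Proof.
move=> [_ dg] Bx; have Fx : Filter (nbhs x) := nbhs_filter x.
rewrite /enorm; apply: (@continuous_comp _ _ _ (fun z => \sum_i grad g z 0 i ^+ 2) Num.sqrt);
  last exact: sqrt_continuous.
apply: cvg_big; first exact: add_continuous.
move=> i _.
rewrite (_ : (fun z => grad g z 0 i ^+ 2) = fun z => partial i g z * partial i g z).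
  by rewrite mxE expr2; case: (dg i) => _ [cp _]; apply: cvgM; exact: cp.
by apply/funext => z; rewrite mxE expr2.
Qed.

Lemma lipschitz_of_grad g (eps : R) x e (s : R) : Ck 1 unit_ball g ->
  (forall y, unit_ball y -> enorm (grad g y) <= eps) ->
  dot e e = 1 -> unit_ball x -> unit_ball (x + s *: e) ->
  `|g (x + s *: e) - g x| <= eps * `|s|.
Proof.
move=> g1 ge e1 /unit_ballE Bx /unit_ballE Bxs.
(* Convexity of the ball, from [|x + h s e|^2 = (1 - h) |x|^2 + h |x + s e|^2 - h (1 - h) s^2]. *)
have inB (h : R) : 0 <= h <= 1 -> unit_ball (x + h *: (s *: e)).
  move=> /andP[h0 h1]; apply/unit_ballE; move: Bxs.
  rewrite !dotDl !dotDr !dotZl !dotZr e1 (dotC e x) !mulr1.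
  move: (dot x x) (dot x e) Bx => a b a1 H.
  have h1' : 0 <= 1 - h by rewrite subr_ge0.
  have k1 := mulr_ge0 (mulr_ge0 h0 h1') (sqr_ge0 s).
  have k2 : h * (a + s * b + (s * b + s * s)) <= h by rewrite ler_piMr // ltW.
  have k3 : (1 - h) * a <= 1 - h by rewrite ler_piMr ?subr_ge0 // ltW.
  move: h0; rewrite le_eqVlt => /orP[/eqP <-|h0]; first by lra.
  have k4 : h * (a + s * b + (s * b + s * s)) < h by rewrite gtr_pMr.
  lra.
pose k (h : R) := g (x + h *: (s *: e)).
pose dk (h : R) := \sum_i (s *: e) 0 i * partial i g (x + h *: (s *: e)).
have D (h : R) : 0 <= h <= 1 -> is_derive h 1 k (dk h).
  by move=> /inB; apply: is_derive_line g1; exact: open_unit_ball.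
have Ck : {within `[0, 1], continuous k}.
  by apply: derivable_within_continuous => h; rewrite in_itv /= => /D[].
have [h] := MVT_segment ler01
  (fun (h : R) (hI : h \in `]0, 1[) => D h (subset_itv_oo_cc hI)) Ck.
rewrite in_itv /= => hI; rewrite /k scale1r scale0r addr0 subr0 mulr1 => ->.
have -> : dk h = s * dot (grad g (x + h *: (s *: e))) e.
  rewrite /dk mulr_sumr; apply: eq_bigr => i _; rewrite !mxE; ring.
rewrite normrM mulrC ler_wpM2r //.
apply: le_trans (ge _ (inB h hI)).
rewrite ler_norml dot_le_enorm // andbT lerNl -dotNr.
by apply: dot_le_enorm; rewrite dotNl dotNr opprK.
Qed.

End EssentialSup.

(** [locally_lipschitz_segment] bounds both sets from above, so their suprema are genuine upper
    bounds rather than default values. *)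
Lemma lipschitz_norm_bounds (R : realType) (f : R -> R) (c : R) : 0 < c ->
  locally_lipschitz_nneg f ->
  [/\ 0 <= lipschitz_norm f 0 c,
      forall t, 0 <= t <= c -> `|f t| <= lipschitz_norm f 0 c &
      forall s t, 0 <= s <= c -> 0 <= t <= c ->
        `|f s - f t| <= lipschitz_norm f 0 c * `|s - t|].
Proof.
move=> c0 /(@locally_lipschitz_segment _ _ c)[M [M0 HM]].
rewrite /lipschitz_norm.
set S1 := [set r | exists2 t, _ & _]; set S2 := [set r | exists s t, _].
have I0 : (0 : R) <= 0 <= c by apply/andP; split=> //; exact: ltW.
have Ic : 0 <= c <= c by apply/andP; split=> //; exact: ltW.
have S1u : has_ubound S1.
  exists (`|f 0| + M * c) => _ [t tI ->].
  have := HM t 0 tI I0; rewrite subr0; have /andP[t0 tc] := tI; rewrite (ger0_norm t0) => h.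
  rewrite -[f t](subrK (f 0)) (le_trans (ler_normD _ _)) // addrC lerD2l (le_trans h) //.
  exact: ler_wpM2l.
have S2u : has_ubound S2.
  exists M => _ [s [t [sI tI st ->]]].
  by rewrite ler_pdivrMr ?normr_gt0 ?subr_eq0 // HM.
have in1 t : 0 <= t <= c -> `|f t| <= sup S1.
  by move=> tI; apply: ub_le_sup => //; exists t.
have in2 s t : 0 <= s <= c -> 0 <= t <= c -> s != t -> `|f s - f t| / `|s - t| <= sup S2.
  by move=> sI tI st; apply: ub_le_sup => //; exists s, t.
have S10 : 0 <= sup S1 by apply: le_trans (in1 0 I0).
have S20 : 0 <= sup S2.
  by apply: le_trans (in2 0 c I0 Ic _); [rewrite divr_ge0|rewrite lt_eqF].
split; first exact: addr_ge0.
  by move=> t tI; apply: le_trans (in1 t tI) _; rewrite lerDl.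
move=> s t sI tI; have [->|st] := eqVneq s t; first by rewrite !subrr normr0 mulr0.
rewrite -ler_pdivrMr ?normr_gt0 ?subr_eq0 //.
by apply: le_trans (in2 s t sI tI st) _; rewrite lerDr.
Qed.

Theorem theorem1p3 (R : realType) (n : nat) (n_ge2 : (2 <= n)%N)
    (L K C0 : R) (C0_ge1 : 1 <= C0) :
  exists alpha C : R, [/\ 0 < alpha, alpha <= 1, 0 < C &
  forall (f : R -> R) (kappa u : 'rV[R]_n -> R),
    lipschitz_norm f 0 C0 = L ->
    Linfty_norm unit_ball kappa = K ->
    locally_lipschitz_nneg f ->
    C1_closure unit_ball kappa ->
    (forall x, closure unit_ball x -> 0 <= kappa x) ->
    Ck 2 unit_ball u ->
    {within closure unit_ball, continuous u} ->
    (forall x, unit_ball x -> - laplacian u x = kappa x * f (u x)) ->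
    (forall x, unit_ball x -> 0 < u x) ->
    (forall x, boundary unit_ball x -> u x = 0) ->
    (forall x, unit_ball x -> C0^-1 * (1 - enorm x) <= u x <= C0) ->
    (forall x y, unit_ball x -> unit_ball y -> enorm x = enorm y ->
       `|u x - u y| <=
         C * (Linfty_norm unit_ball (fun z => enorm (grad kappa z))) `^ alpha) /\
    (forall x, unit_ball x -> x != 0 ->
       radial_derivative u x <
         C * (Linfty_norm unit_ball (fun z => enorm (grad kappa z))) `^ alpha)].
Proof.
have K0 := normr_ge0 K; have L0 := normr_ge0 L.
(* The constants are chosen before [f] and [kappa], when [K] and [L] are arbitrary reals; absolute
   values make them nonnegative and disappear once [K] and [L] are known to be norms. *)
pose c1 := symmetry_constant `|K| `|L| C0; pose c2 := radial_constant `|K| `|L| C0 + 1.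
have c1_ge0 : 0 <= c1 by exact: symmetry_constant_ge0.
have c2_gt0 : 0 < c2 by apply: ltr_wpDl => //; exact: radial_constant_ge0.
have C0_gt0 : 0 < C0 by exact: lt_le_trans C0_ge1.
have n_gt0 : (0 < n)%N by exact: ltnW.
(* The exponent is 1, and the sum of the two constants serves both estimates. *)
exists 1, (c1 + c2); split => //; first exact: ltr_wpDl.
move=> f kappa u Lf Kk lf kc1 kge0 uC2 uc eqn upos ubd ubounds.
rewrite powRr1; last exact: Linfty_norm_ge0.
set eps := Linfty_norm _ _; have eps0 : 0 <= eps by exact: Linfty_norm_ge0.
have [L_ge0 f_bound f_lip] := lipschitz_norm_bounds C0_gt0 lf.
rewrite Lf in L_ge0 f_bound f_lip.
have [kC1 kc _] := kc1.
have [Mk _ HMk] := bounded_on_closure kc.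
have oB := @open_unit_ball R n.
have kappa_bound x : unit_ball x -> 0 <= kappa x <= K.
  move=> Bx; rewrite kge0; last exact: subset_closure.
  rewrite -Kk (le_trans (ler_norm _)) //.
  by apply: le_Linfty_norm oB _ HMk Bx => //; case: kC1.
have K_ge0 : 0 <= K by rewrite -Kk Linfty_norm_ge0.
have [Mg HMg] := enorm_grad_bounded kc1.
have grad_le x : unit_ball x -> enorm (grad kappa x) <= eps.
  move=> Bx; rewrite -[leLHS]ger0_norm ?enorm_ge0 //.
  apply: (@le_Linfty_norm _ _ _ (fun z => enorm (grad kappa z)) Mg) => //.
    by move=> y By; exact: enorm_grad_continuous.
  by move=> y By; rewrite ger0_norm ?enorm_ge0 // HMg.
have kappa_lip x e (s : R) : dot e e = 1 -> unit_ball x -> unit_ball (x + s *: e) ->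
    `|kappa (x + s *: e) - kappa x| <= eps * `|s|.
  exact: lipschitz_of_grad.
have usphere x : dot x x = 1 -> u x = 0 by move=> x1; apply: ubd; exact: sphere_boundary.
have ulow x : unit_ball x -> C0^-1 * (1 - enorm x) <= u x by move=> /ubounds/andP[].
have uup x : unit_ball x -> u x <= C0 by move=> /ubounds/andP[].
have c1E : c1 = symmetry_constant K L C0 by rewrite /c1 !ger0_norm.
have c2E : c2 = radial_constant K L C0 + 1 by rewrite /c2 !ger0_norm.
have sym x z : unit_ball x -> unit_ball z -> dot z z <= dot x x -> u x - u z <= c1 * eps.
  rewrite c1E; exact: (almost_radial K_ge0 L_ge0 eps0 C0_ge1 uC2 uc eqn upos usphere ulow uup
    kappa_bound kappa_lip f_bound f_lip).
have c1_le : c1 * eps <= (c1 + c2) * eps by rewrite ler_wpM2r // lerDl ltW.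
have c2_le : c2 * eps <= (c1 + c2) * eps by rewrite ler_wpM2r // lerDr.
split=> [x y Bx By xy|x Bx x0].
  (* For equal norms the one-sided estimate [sym] applies in both orders, which bounds the absolute
     value. *)
  have dxy : dot x x = dot y y by rewrite -!sqr_enorm xy.
  apply: le_trans c1_le; rewrite ler_norml lerNl opprB.
  by rewrite !sym // dxy.
apply: lt_le_trans c2_le; rewrite c2E.
exact: (radial_derivative_lt K_ge0 L_ge0 eps0 C0_ge1 uC2 uc eqn upos usphere ulow uup
  kappa_bound kappa_lip f_bound f_lip).
Qed.
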